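(* Assume that $(X,T)$ is a dynamical system with a regular periodic decomposition $\{D_0,\ldots,D_{r-1}\}$ and that $(D_0,T^r)$ has the asymptotic average shadowing property. If $V\subset\mathcal{M}_T(X)$ is nonempty, closed and connected, then there is a point $x\in X$ such that $\hat\omega(x)=V$. In particular, every $T$-invariant measure has a generic point.
   Context: A dynamical system $(X,T)$ is a compact metric space $X$ (metric $\rho$, diameter $1$ without loss of generality) with a continuous map $T\colon X\to X$. A collection $\{D_0,\ldots,D_{r-1}\}$ of subsets of $X$ is a regular periodic decomposition if: (1) $T(D_i)\subset D_{(i+1)\bmod r}$ for $0\le i<r$; (2) $D_i=\overline{\operatorname{int}(D_i)}$ for each $0\le i<r$; (3) $D_i\cap D_j$ is nowhere dense whenever $i\ne j$; (4) $\bigcup_{i=0}^{r-1}D_i=X$. $(D_0,T^r)$ denotes the dynamical system given by the restriction of $T^r$ to $D_0$. For a dynamical system $(Y,S)$ with metric $\rho$: a sequence $\{y_n\}_{n=0}^\infty$ in $Y$ is an asymptotic average pseudoorbit if $\lim_{N\to\infty}\frac1N\sum_{n=0}^{N-1}\rho(S(y_n),y_{n+1})=0$; it is asymptotically shadowed in average by $y\in Y$ if $\lim_{N\to\infty}\frac1N\sum_{n=0}^{N-1}\rho(S^n(y),y_n)=0$; $(Y,S)$ has the asymptotic average shadowing property if every asymptotic average pseudoorbit is asymptotically shadowed in average by some point of $Y$. $\mathcal{M}_T(X)$ is the set of $T$-invariant Borel probability measures on $X$ with the weak$^*$ topology. For $x\in X$ and $n\ge1$ let $\mathfrak{m}(x,n)=\frac1n\sum_{j=0}^{n-1}\hat\delta(T^j(x))$,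 where $\hat\delta(y)$ is the Dirac measure at $y$; $\hat\omega(x)$ is the set of all weak$^*$ limits of subsequences of $\{\mathfrak{m}(x,n)\}_{n=1}^\infty$. A point $x$ is generic for $\mu$ if $\mathfrak{m}(x,n)\to\mu$ in the weak$^*$ topology. *)

(* Defs.v *)
From HB Require Import structures.
From mathcomp Require Import all_boot all_order all_algebra.
From mathcomp Require Import all_classical all_reals all_analysis.
Import Order.TTheory GRing.Theory Num.Theory.
Import numFieldNormedType.Exports.

Set Implicit Arguments.
Unset Strict Implicit.
Unset Printing Implicit Defensive.

Local Open Scope classical_set_scope.
Local Open Scope ring_scope.

(* The library's measurable types are pointed, hence so must be a metric space
   that carries Borel measures; this only excludes the empty space. *)
#[short(type="pmetricType")]
HB.structure Definition PointedMetric (K : numDomainType) :=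
  { M of Metric K M & Pointed M }.

Section decomposition.
Context {X : topologicalType}.

Definition nowhere_dense (A : set X) : Prop := (closure A)° = set0.

(* [ordS i] is (i + 1) mod r. *)
Record regular_periodic_decomposition (T : X -> X) (r : nat)
    (D : 'I_r -> set X) : Prop := {
  rpd_image : forall i, T @` D i `<=` D (ordS i) ;
  rpd_regclosed : forall i, D i = closure (D i)° ;
  rpd_nowhere_dense : forall i j, i != j -> nowhere_dense (D i `&` D j) ;
  rpd_cover : \bigcup_(i in [set: 'I_r]) D i = [set: X] }.

End decomposition.

Section shadowing.
Context {R : realType} {X : metricType R}.

(* [arithmetic_mean u n] is the mean of u 0, ..., u n (that is, of n + 1
   terms). *)
Definition asymptotic_average_pseudoorbit (S : X -> X) (y : nat -> X) : Prop :=
  arithmetic_mean (fun n => mdist (S (y n)) (y n.+1)) @ \oo --> (0 : R).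

Definition asymptotically_shadowed_in_average (S : X -> X) (y : nat -> X)
    (z : X) : Prop :=
  arithmetic_mean (fun n => mdist (iter n S z) (y n)) @ \oo --> (0 : R).

(* The property of the system (Y, S|_Y), where Y is a subset of X with
   S(Y) contained in Y, equipped with the restriction of the metric of X. *)
Definition asymptotic_average_shadowing (Y : set X) (S : X -> X) : Prop :=
  forall y : nat -> X, (forall n, Y (y n)) ->
    asymptotic_average_pseudoorbit S y ->
    exists2 z, Y z & asymptotically_shadowed_in_average S y z.

End shadowing.

Notation borel X := (g_sigma_algebraType (@open X)).

Section measures.
Context {R : realType}.

(* The Borel probability measures on X with the weak* topology: the coarsest
   one making mu |-> \int f dmu continuous for all continuous f : X -> R.
   X is meant to be compact, so that every such f is bounded.
   A [probability] is a function on all subsets of X, constrained only on the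
   measurable ones; two of them that agree on the Borel sets are
   indistinguishable for this topology, so the junk values elsewhere do not
   affect limits, and closed sets are unions of classes of such measures. *)
Definition weak_star_probability (X : pmetricType R) : topologicalType :=
  initial_topology
    (fun (mu : probability (borel X) R) =>
       (fun f : continuousType X R => \int[mu]_x f x)
         : {ptws continuousType X R -> R}).

Context {X : pmetricType R}.

Definition invariant_measures (T : X -> X) : set (weak_star_probability X) :=
  [set mu : probability (borel X) R |
    forall A : set (borel X), measurable A -> mu (T @^-1` A) = mu A].

Section empirical.
Variables (T : X -> X) (x : X) (n : nat).

(* The average of the Dirac measures at x, T x, ..., T^n x: n + 1 terms, so
   that the sequence of all empirical measures is indexed from 0. *)
Definition empirical : set (borel X) -> \bar R :=
  mscale (n.+1%:R^-1)%:nng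
    (msum (fun j => @dirac _ (borel X) (iter j T x) R) n.+1).

HB.instance Definition _ := Measure.on empirical.

Let empirical_setT : empirical [set: borel X] = 1%E.
Proof.
rewrite -[LHS]/(_ * \sum_(k < n.+1) @dirac _ (borel X) (iter k T x) R setT)%E.
rewrite (eq_bigr (fun=> 1%:E)); last by move=> i _; rewrite diracT.
by rewrite sumEFin sumr_const card_ord -EFinM mulVf // pnatr_eq0.
Qed.

HB.instance Definition _ :=
  Measure_isProbability.Build _ _ _ empirical empirical_setT.

Definition empirical_measure : weak_star_probability X :=
  (empirical : probability (borel X) R).

End empirical.

(* All limits of subsequences of the empirical measures of x. *)
Definition omega_hat (T : X -> X) (x : X) : set (weak_star_probability X) :=
  [set mu | exists2 k : nat -> nat,
    {homo k : i j / (i < j)%N} &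
    (fun i => empirical_measure T x (k i)) @ \oo --> mu].

Definition generic_point (T : X -> X) (mu : weak_star_probability X) (x : X) :
    Prop :=
  empirical_measure T x @ \oo --> mu.

End measures.

(* Main.v *)
Require Import Defs.
From mathcomp Require Import all_boot all_order all_algebra.
From mathcomp Require Import all_classical all_reals all_analysis.
From mathcomp Require Import measurable_realfun.
From mathcomp Require Import ring lra.
Import Order.TTheory GRing.Theory Num.Theory.
Import numFieldNormedType.Exports.

Set Implicit Arguments.
Unset Strict Implicit.
Unset Printing Implicit Defensive.

Local Open Scope classical_set_scope.
Local Open Scope ring_scope.

(* An invariant measure mu is the mu-average of the empirical measures of
   orbit segments of any fixed length, so it is approximated by a finite
   concatenation of long orbit segments; moving each segment by at most r steps
   makes it start in D_0.  Since V is connected, there is a sequence of measures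
   of V with vanishing jumps that accumulates at every point of V.
   Concatenating approximations of its successive terms, each repeated so often
   that it outweighs its past, yields a sequence in D_0 that is an orbit of T^r
   but for jumps of density zero, hence an asymptotic average pseudoorbit of
   T^r; a point shadowing it has the same asymptotic averages, along T^r for the
   functions 1/r * sum_(l < r) g o T^l, hence along T for g.  Invariance of the
   limits of empirical measures is only needed because V is closed merely in
   the space of invariant measures.  The weak* topology is handled
   through a sequence of test functions with dense linear span. *)

(** * Slow concatenation of finite sequences *)

(** Since [L n] has more than n entries and later lists only extend it, its entry n is final; these
    diagonal entries form [y]. *)
Lemma sequence_of_prefixes (A : Type) (L : nat -> seq A) :
  (forall k, exists s, L k.+1 = L k ++ s) -> (forall k, (k < size (L k))%N) ->
  exists y : nat -> A, forall k, mkseq y (size (L k)) = L k.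
Proof.
move=> Lext Lsize.
have Lmono k m : (k <= m)%N -> exists s, L m = L k ++ s.
  elim: m => [|m IH]; first by rewrite leqn0 => /eqP ->; exists [::]; rewrite cats0.
  rewrite leq_eqVlt => /orP[/eqP ->|]; first by exists [::]; rewrite cats0.
  rewrite ltnS => /IH [s Es]; have [s' Es'] := Lext m.
  by exists (s ++ s'); rewrite Es' Es catA.
have d : A by case: (L 0%N) (Lsize 0%N).
exists (fun n => nth d (L n) n) => k.
apply: (@eq_from_nth _ d); first by rewrite size_mkseq.
move=> i; rewrite size_mkseq => ik; rewrite nth_mkseq //.
case: (leqP k i) => [/Lmono [s ->]|/ltnW /Lmono [s ->]]; rewrite nth_cat ?ik //.
by rewrite Lsize.
Qed.

Lemma big_mkseq (R : realType) (A : Type) (y : nat -> A) (N : nat) (f : A -> R) :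
  \sum_(n < N) f (y n) = \sum_(p <- mkseq y N) f p.
Proof. by rewrite big_map -(big_mkord xpredT (f \o y)) /index_iota subn0. Qed.

Lemma sum_cst_seq (R : realType) (A : Type) (s : seq A) (c : R) :
  \sum_(p <- s) c = (size s)%:R * c.
Proof.
by rewrite big_const_seq count_predT -Monoid.iteropE mulr_natl.
Qed.

Lemma ler_norm_sum_size (R : realType) (A : Type) (f : A -> R) (s : seq A) :
  (forall p, `|f p| <= 1) -> `|\sum_(p <- s) f p| <= (size s)%:R.
Proof.
move=> f1; apply: (le_trans (ler_norm_sum _ _ _)).
apply: (le_trans (ler_sum _ (fun p _ => f1 p))).
by rewrite sum_cst_seq mulr1.
Qed.

(** The prefix consists of complete copies of [U], whose sums are small, and at most one incomplete
    copy of fewer than [size U] terms. *)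
Lemma ler_norm_sum_take_nseq (R : realType) (A : Type) (f : A -> R) (U : seq A)
    (c : R) (M m : nat) :
  0 <= c -> (forall p, `|f p| <= 1) ->
  `|\sum_(p <- U) f p| <= c * (size U)%:R ->
  `|\sum_(p <- take m (flatten (nseq M U))) f p| <= c * m%:R + (size U)%:R.
Proof.
move=> c0 f1 fU; elim: M m => [|M IH] m /=.
  by rewrite big_nil normr0 addr_ge0 ?mulr_ge0.
rewrite take_cat; case: ltnP => mU.
  apply: (le_trans (ler_norm_sum_size _ f1)); rewrite size_take mU.
  by rewrite -[leLHS]add0r lerD ?mulr_ge0 // ler_nat ltnW.
rewrite big_cat /=; apply: (le_trans (ler_normD _ _)).
apply: (le_trans (lerD fU (IH _))).
by rewrite addrA -mulrDr -natrD subnKC.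
Qed.

Lemma size_flatten_nseq (A : Type) (M : nat) (U : seq A) :
  size (flatten (nseq M U)) = (M * size U)%N.
Proof. by elim: M => //= M IH; rewrite size_cat IH mulSn. Qed.

(* The unit [U k] is repeated so often that its length outweighs both all that
   precedes it and the next unit. *)
Fixpoint slow_concat (A : Type) (U : nat -> seq A) (k : nat) : seq A :=
  if k is k'.+1 then
    slow_concat U k' ++
    flatten (nseq (k'.+2 * (size (slow_concat U k') + size (U k'.+2))) (U k))
  else U 0%N.

Section slow_concatenation.
Context {R : realType} {A : Type}.
(** [h j] is the j-th observed quantity and [a k j] the average that it should have over the unit
    [U k]. *)
Variables (U : nat -> seq A) (h : nat -> A -> R) (a : nat -> nat -> R).
Hypothesis U_gt0 : forall k, (0 < size (U k))%N.
Hypothesis ha : forall j p k, `|h j p - a k j| <= 1.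
Hypothesis Ua : forall k j, (j <= k)%N ->
  `|\sum_(p <- U k) (h j p - a k j)| <= k.+1%:R^-1 * (size (U k))%:R.

Let L := slow_concat U.

Lemma slow_concat_size k : (k < size (L k))%N.
Proof.
elim: k => [|k IH] /=; first exact: U_gt0.
rewrite size_cat size_flatten_nseq -addn1 leq_add // !muln_gt0 /= U_gt0 andbT.
by rewrite addn_gt0 U_gt0 orbT.
Qed.

Lemma slow_concat_units k :
  exists t : seq nat, L k = flatten [seq U i | i <- t].
Proof.
elim: k => [|k [t IH]]; first by exists [:: 0%N]; rewrite /= cats0.
exists (t ++ nseq (k.+2 * (size (L k) + size (U k.+2))) k.+1).
by rewrite map_cat flatten_cat map_nseq -IH.
Qed.

(** An incomplete copy of the next unit is thus negligible against what precedes it. *)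
Lemma slow_concat_unit_size k :
  (k.+2 * size (U k.+2) <= size (L k.+1))%N.
Proof.
rewrite /= size_cat size_flatten_nseq -[X in (X <= _)%N]add0n leq_add //.
rewrite -[X in (X <= _)%N]muln1 leq_mul ?U_gt0 //.
by rewrite leq_mul // leq_addl.
Qed.

(** The repeated unit has relative error [k.+2%:R^-1]. The past [slow_concat U k] has at most that
    fraction of the length of the repetitions and errs by at most 1 per entry. *)
Lemma slow_concat_sum k j : (j <= k.+1)%N ->
  `|\sum_(p <- L k.+1) (h j p - a k.+1 j)|
  <= 2 * k.+2%:R^-1 * (size (L k.+1))%:R.
Proof.
move=> jk; rewrite /= big_cat /= size_cat.
set F := flatten _; apply: (le_trans (ler_normD _ _)).
have h1 := ler_norm_sum_size (slow_concat U k) (fun p => ha j p k.+1).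
have : `|\sum_(p <- F) (h j p - a k.+1 j)| <= k.+2%:R^-1 * (size F)%:R.
  rewrite /F; elim: (k.+2 * _)%N => [|M IH] /=.
    by rewrite big_nil normr0 mulr_ge0 // invr_ge0.
  rewrite big_cat /= size_cat natrD mulrDr; apply: (le_trans (ler_normD _ _)).
  by rewrite lerD // Ua.
have : (size (slow_concat U k))%:R <= k.+2%:R^-1 * (size F)%:R :> R.
  rewrite ler_pdivlMl ?ltr0n // -natrM ler_nat /F size_flatten_nseq.
  rewrite -[X in (X <= _)%N]muln1 leq_mul ?U_gt0 //.
  by rewrite leq_mul // leq_addr.
have k0 : 0 <= k.+2%:R^-1 :> R by rewrite invr_ge0.
have l0 : 0 <= (size (slow_concat U k))%:R :> R by [].
rewrite natrD; move: h1 k0 l0.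
move: (k.+2%:R^-1) ((size (slow_concat U k))%:R) ((size F)%:R) => c u v.
move: (`| _ |) (`| _ |) => w z *.
have : 0 <= c * u by rewrite mulr_ge0.
nra.
Qed.

(** [b k] is the length of [slow_concat U k]. Between [b k.+1] and [b k.+2], the copies of [U k.+2]
    seen so far meet the new target, the prefix [slow_concat U k.+1] meets the previous one, whence
    the change of target in the bound, and the incomplete copy is short. *)
Lemma slow_concatenation :
  exists (y : nat -> A) (b : nat -> nat),
  [/\ forall k, (k < b k)%N, {homo b : i j / (i < j)%N},
      forall k, exists t : seq nat, mkseq y (b k) = flatten [seq U i | i <- t] &
      forall k j N, (j <= k.+1)%N -> (b k.+1 <= N <= b k.+2)%N ->
        `|\sum_(n < N) (h j (y n) - a k.+2 j)|
        <= (4 * k.+2%:R^-1 + `|a k.+2 j - a k.+1 j|) * N%:R].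
Proof.
have [|y yL] := @sequence_of_prefixes _ L _ slow_concat_size.
  by move=> k; eexists; reflexivity.
exists y, (size \o L); split; first exact: slow_concat_size.
    apply: homo_ltn => [? ? ?|k]; first exact: ltn_trans.
    rewrite /= size_cat -[X in (X < _)%N]addn0 ltn_add2l size_flatten_nseq.
    by rewrite !muln_gt0 U_gt0 andbT addn_gt0 U_gt0 orbT.
  by move=> k; rewrite /= yL; exact: slow_concat_units.
move=> k j N jk /= /andP[LN NL].
have -> : \sum_(n < N) (h j (y n) - a k.+2 j) =
    \sum_(p <- take N (L k.+2)) (h j p - a k.+2 j).
  rewrite (big_mkseq y N (fun p => h j p - a k.+2 j)) -yL.
  by rewrite /mkseq -map_take take_iota; congr bigop; rewrite (minn_idPl _).
have -> : L k.+2 = L k.+1 ++ flatten (nseq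
   (k.+3 * (size (L k.+1) + size (U k.+3))) (U k.+2)) by [].
rewrite take_cat ltnNge LN /= big_cat /=.
have H1 := @ler_norm_sum_take_nseq R A (fun p => h j p - a k.+2 j) (U k.+2)
  k.+3%:R^-1 (k.+3 * (size (L k.+1) + size (U k.+3))) (N - size (L k.+1))
  ltac:(by rewrite invr_ge0) (fun p => ha j p k.+2) (Ua (leqW jk)).
apply: (le_trans (ler_normD _ _)); apply: (le_trans (lerD (lexx _) H1)).
have H2 := slow_concat_sum jk.
have -> : \sum_(p <- L k.+1) (h j p - a k.+2 j) =
   \sum_(p <- L k.+1) (h j p - a k.+1 j)
   - (a k.+2 j - a k.+1 j) * (size (L k.+1))%:R.
  by rewrite mulrC -sum_cst_seq -sumrB; apply: eq_bigr => p _; ring.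
have H3 : (size (U k.+2))%:R <= k.+2%:R^-1 * (size (L k.+1))%:R :> R.
  by rewrite ler_pdivlMl ?ltr0n // -natrM ler_nat slow_concat_unit_size.
have H4 := ler_normB (\sum_(p <- L k.+1) (h j p - a k.+1 j))
  ((a k.+2 j - a k.+1 j) * (size (L k.+1))%:R).
have H5 : k.+3%:R^-1 <= k.+2%:R^-1 :> R by rewrite lef_pV2 ?posrE ?ltr0n // ler_nat.
have H6 : (size (L k.+1))%:R <= N%:R :> R by rewrite ler_nat.
have H7 : 0 <= k.+3%:R^-1 :> R by rewrite invr_ge0.
rewrite natrB //.
move: H4; rewrite normrM normr_nat => H4.
have d0 := normr_ge0 (a k.+2 j - a k.+1 j).
have s0 : 0 <= (size (L k.+1))%:R :> R by [].
move: (`|a k.+2 j - a k.+1 j|) (k.+2%:R^-1) (k.+3%:R^-1) ((size (L k.+1))%:R)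
  (N%:R) H2 H3 H4 H5 H6 H7 d0 s0 => d c e l n.
move: (`| _ |) (`| _ |) ((size (U k.+2))%:R) => u v w H2 H3 H4 H5 H6 H7 d0 s0.
have ? : 0 <= (c - e) * (n - l) by rewrite mulr_ge0 ?subr_ge0.
have ? : 0 <= c * (n - l) by rewrite mulr_ge0 ?subr_ge0 // (le_trans H7).
have ? : 0 <= d * (n - l) by rewrite mulr_ge0 ?subr_ge0.
nra.
Qed.

End slow_concatenation.

(** * Continuous functions and the weak* topology *)

Section uniform_continuity.
Context {R : realType} {X : metricType R}.

(** Around each point, nearby centres and small radii work together; compactness, in its near
    covering form, makes one radius serve all centres. *)
Lemma compact_uniform_continuity (f : X -> R) (e : R) :
  compact [set: X] -> continuous f -> 0 < e ->
  exists2 d : R, 0 < d & forall x y, mdist x y < d -> `|f x - f y| <= e.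
Proof.
move=> /compact_near_coveringP cX cf e0.
have /(_ _) := cX R 0^'+ (fun d x => forall y, mdist x y < d -> `|f x - f y| <= e).
case.
  move=> x _; have e2 : 0 < e / 2 by rewrite divr_gt0.
  have := cf x; move=> /cvgrPdist_le /(_ _ e2).
  rewrite -metricType_numDomainType.filter_from_mdist_nbhs => -[d /= d0 xd].
  have d2 : 0 < d / 2 by rewrite divr_gt0.
  exists ([set z | mdist x z < d / 2], [set t : R | t < d / 2]) => /=.
    split; last by near=> t; near: t; exact: nbhs_right_lt.
    rewrite -metricType_numDomainType.filter_from_mdist_nbhs.
    by exists (d / 2).
  move=> [z t] /= [xz td] y zy.
  rewrite -(subrKA (f x)) (le_trans (ler_normD _ _)) // [leRHS]splitr lerD //.
    rewrite distrC; apply: xd; apply: (lt_le_trans xz).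
    by move: d0; clear; lra.
  apply: xd; apply: (le_lt_trans (metric_triangle _ z _)).
  by rewrite [ltRHS]splitr ltrD // (lt_trans zy).
move=> d /= d0 Hd; exists (d / 2); first by rewrite divr_gt0.
move=> x y; apply: (Hd (d / 2)) => //=.
  by rewrite sub0r normrN gtr0_norm ?divr_gt0 //; move: d0; clear; lra.
by rewrite divr_gt0.
Unshelve. all: by end_near. Qed.

Lemma compact_bounded_function (f : X -> R) :
  compact [set: X] -> continuous f -> exists M, forall x, `|f x| <= M.
Proof.
move=> cX cf.
have /compact_bounded [M [_ /(_ (M + 1)) MP]] : compact [set f x | x in [set: X]].
  by apply: continuous_compact => //; exact/continuous_subspaceT.
exists (M + 1) => x; apply: MP; first by rewrite ltrDl.
by exists x.
Qed.

End uniform_continuity.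

Lemma continuous_sum (R : realType) (Y : topologicalType) (I : Type)
    (s : seq I) (F : I -> Y -> R) :
  (forall i, continuous (F i)) -> continuous (fun x => \sum_(i <- s) F i x).
Proof.
move=> cF; elim: s => [|i s IH].
  by under eq_fun do rewrite big_nil; move=> x; exact: cvg_cst.
under eq_fun do rewrite big_cons.
by move=> x; apply: cvgD; [exact: cF | exact: IH].
Qed.

Section weak_star.
Context {R : realType} {X : pmetricType R}.

Definition mean (mu : weak_star_probability X) (f : X -> R) : R :=
  \int[(mu : probability (borel X) R)]_(x in [set: borel X]) f x.

(** The topology is initial for a map into a product, so convergence is coordinatewise. The form
    with filters covers both sequences and neighbourhoods of a measure. *)
Lemma weak_star_cvgP (F : set_system (weak_star_probability X))
    (mu : weak_star_probability X) : Filter F ->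
  F --> mu <-> (forall f : X -> R, continuous f ->
     (fun nu => mean nu f) @ F --> mean mu f).
Proof.
move=> FF; split=> [Fmu f cf|Fmu].
  pose g : continuousType X R := mkcts cf.
  pose h := (fun nu : probability (borel X) R =>
       (fun f : continuousType X R => \int[nu]_x f x)
         : {ptws continuousType X R -> R}).
  have := @initial_continuous _ _ h mu.
  rewrite /continuous_at.
  have /[swap] := @proj_continuous _ (fun _ : continuousType X R => R) g (h mu).
  move=> A B.
  exact: (cvg_trans (cvg_app _ (cvg_trans (cvg_app _ Fmu) A)) B).
move=> A /=; rewrite nbhsE => -[B [[C oC CB] Bmu] BA].
rewrite nbhs_filterE; apply: filterS BA _; rewrite -CB.
pose h := (fun nu : probability (borel X) R =>
       (fun f : continuousType X R => \int[nu]_x f x)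
         : {ptws continuousType X R -> R}).
suff : h @ F --> h mu.
  apply; apply: open_nbhs_nbhs; split => //.
  by move: Bmu; rewrite -CB.
apply/cvg_sup => g.
suff H (D : set (initial_topology (fun f : continuousType X R -> R => f g))) :
    nbhs (h mu : initial_topology (fun f : continuousType X R -> R => f g)) D ->
    (h @ F) D by exact: H.
rewrite nbhsE => -[E [[G oG GE] Emu] ED].
have : (h @ F) E; last by exact: filterS.
rewrite -GE; apply: (Fmu g); first exact: cts_fun.
by apply: open_nbhs_nbhs; split=> //; move: Emu; rewrite -GE.
Qed.

Lemma continuous_measurable (f : X -> R) : continuous f ->
  measurable_fun [set: borel X] (f : borel X -> R).
Proof.
move=> /continuousP cf.
apply: (measurability _ (@RGenOpens.measurableE R)) => _ [_ [a [b ->] <-]].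
rewrite setTI; apply: sub_sigma_algebra; apply: cf; exact: interval_open.
Qed.

Lemma continuous_borel_measurable (T : X -> X) : continuous T ->
  measurable_fun [set: borel X] (T : borel X -> borel X).
Proof.
move=> /continuousP cT.
apply: (@measurability _ _ (borel X) (borel X) setT T (@open X) erefl).
by move=> _ [A oA <-]; rewrite setTI; apply: sub_sigma_algebra; exact: cT.
Qed.

Hypothesis compactX : compact [set: X].

Lemma continuous_integrable (mu : weak_star_probability X) (f : X -> R) :
  continuous f ->
  (mu : probability (borel X) R).-integrable [set: borel X] (EFin \o f).
Proof.
move=> cf; apply: measurable_bounded_integrable => //.
- by rewrite [X in (X < _)%E](_ : _ = 1%E) ?ltry //; exact: probability_setT.
- exact: continuous_measurable.
have [M fM] := compact_bounded_function compactX cf.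
exists M; split; first by rewrite num_real.
by move=> y My x _; exact: (le_trans (fM x) (ltW My)).
Qed.

Lemma mean_cst mu (c : R) : mean mu (cst c) = c.
Proof.
rewrite /mean Rintegral_cst // [X in fine X](_ : _ = 1%E) ?mulr1 //.
exact: probability_setT.
Qed.

Lemma meanD mu (f g : X -> R) : continuous f -> continuous g ->
  mean mu (fun x => f x + g x) = mean mu f + mean mu g.
Proof. by move=> cf cg; apply: RintegralD => //; exact: continuous_integrable. Qed.

Lemma meanZ mu c (f : X -> R) : continuous f ->
  mean mu (fun x => c * f x) = c * mean mu f.
Proof. by move=> cf; apply: RintegralZl => //; exact: continuous_integrable. Qed.

Lemma mean_sum mu (I : Type) (s : seq I) (F : I -> X -> R) :
  (forall i, continuous (F i)) ->
  mean mu (fun x => \sum_(i <- s) F i x) = \sum_(i <- s) mean mu (F i).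
Proof.
move=> cF; elim: s => [|i s IH].
  by under eq_fun do rewrite big_nil; rewrite big_nil (mean_cst mu 0).
under eq_fun do rewrite big_cons.
by rewrite meanD ?IH ?big_cons //; exact: continuous_sum.
Qed.

Lemma le_mean mu (f g : X -> R) : continuous f -> continuous g ->
  (forall x, f x <= g x) -> mean mu f <= mean mu g.
Proof.
by move=> cf cg fg; apply: le_Rintegral => //; exact: continuous_integrable.
Qed.

Lemma mean_ge0_le1 mu (f : X -> R) : continuous f ->
  (forall x, 0 <= f x <= 1) -> 0 <= mean mu f <= 1.
Proof.
move=> cf f01; have c1 (c : R) : continuous (cst c : X -> R).
  by move=> x; exact: cvg_cst.
apply/andP; split.
  by rewrite -(mean_cst mu 0) le_mean // => x; have /andP[] := f01 x.
by rewrite -[leRHS](mean_cst mu 1) le_mean // => x; have /andP[] := f01 x.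
Qed.

Lemma mean_dist_le mu (f g : X -> R) e : continuous f -> continuous g ->
  (forall x, `|f x - g x| <= e) -> `|mean mu f - mean mu g| <= e.
Proof.
move=> cf cg fg; have cc : continuous (cst e : X -> R) by move=> x; exact: cvg_cst.
have H (u v : X -> R) : continuous u -> continuous v ->
    (forall x, u x <= v x + e) -> mean mu u <= mean mu v + e.
  move=> cu cv uv; rewrite -[X in _ + X](mean_cst mu) -meanD //.
  by apply: le_mean => // x; apply: cvgD; [exact: cv|exact: cc].
rewrite ler_distlC lerBlDr !H // => x; have := fg x; rewrite ler_norml => /andP[]; lra.
Qed.

Lemma mean_empirical (T : X -> X) x n (f : X -> R) :
  continuous f -> (forall y, 0 <= f y) ->
  mean (empirical_measure T x n) f =
  n.+1%:R^-1 * \sum_(j < n.+1) f (iter j T x).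
Proof.
move=> cf f0.
have mf : measurable_fun [set: borel X] (EFin \o f).
  by apply/measurable_EFinP; exact: continuous_measurable.
rewrite /mean /Rintegral /= ge0_integral_mscale //=; last first.
  by move=> y _; rewrite lee_fin.
rewrite ge0_integral_measure_sum //=; last by move=> y _; rewrite lee_fin.
under eq_bigr => j _ do rewrite integral_dirac // diracT mul1e.
by rewrite sumEFin.
Qed.

Lemma mean_invariant (T : X -> X) mu (f : X -> R) : continuous T ->
  invariant_measures T mu -> continuous f -> (forall x, 0 <= f x) ->
  mean mu (f \o T) = mean mu f.
Proof.
move=> cT muT cf f0.
have mT := continuous_borel_measurable cT.
rewrite /mean /Rintegral; congr fine.
have mf : measurable_fun [set: borel X] (EFin \o f).
  by apply/measurable_EFinP; exact: continuous_measurable.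
have -> : (\int[mu : probability (borel X) R]_(x in [set: borel X]) (f x)%:E =
   \int[pushforward (mu : probability (borel X) R) (T : borel X -> borel X)]_(x
     in [set: borel X]) (f x)%:E)%E.
  by apply: eq_measure_integral => A mA _; rewrite -[LHS]muT.
rewrite ge0_integral_pushforward //.
by move=> x _; rewrite lee_fin.
Qed.

End weak_star.

(** * Continuous functions determine Borel measures *)

Section metric_functions.
Context {R : realType} {X : metricType R}.

Lemma nonexpansive_continuous (f : X -> R) :
  (forall x y, f x <= f y + mdist x y) -> continuous f.
Proof.
move=> fl x; apply/cvgrPdist_le => e e0.
apply/metricType_numDomainType.nbhs_mdistP.
exists e => //= y /ltW xy; have := fl x y; have := fl y x.
rewrite (metric_sym y x) => h1 h2.
by rewrite ler_norml; apply/andP; split; lra.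
Qed.

Lemma continuous_mdist (a : X) : continuous (mdist a : X -> R).
Proof.
apply: nonexpansive_continuous => x y; rewrite (metric_sym x y); exact: metric_triangle.
Qed.

(** The functions are the minimum of 1 and n times the distance to the complement of [A], which is
    positive on [A] because [A] is open. *)
Lemma open_indicator_limit (A : set X) : open A ->
  exists f : nat -> X -> R,
  [/\ forall n, continuous (f n), forall n x, 0 <= f n x,
      forall x m n, (m <= n)%N -> f m x <= f n x &
      forall x, f n x @[n --> \oo] --> (\1_A x : R)].
Proof.
(* When [A] is the whole space, the distance would be an infimum over the empty set; the constant 1
   serves instead. *)
move=> oA; have [AT|/set0P[a0 Aa0]] := eqVneq (~` A) set0.
  exists (fun _ _ => 1); split=> // [n x|x]; first exact: cvg_cst.
  rewrite indicE mem_set; first exact: cvg_cst.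
  by apply: contrapT => nAx; have : (~` A) x by []; rewrite AT.
pose D x := [set mdist x a | a in ~` A].
pose d x := inf (D x).
have Dinf x : has_inf (D x).
  split; first by exists (mdist x a0), a0.
  by exists 0 => _ [a _ <-]; exact: mdist_ge0.
have d_le x a : ~ A a -> d x <= mdist x a.
  by move=> nAa; apply: ge_inf; [have [] := Dinf x | exists a].
have le_d x r : (forall a, ~ A a -> r <= mdist x a) -> r <= d x.
  by move=> H; apply: lb_le_inf; [have [] := Dinf x | move=> _ [a nAa <-]; exact: H].
have d0 x : 0 <= d x by apply: le_d => a _; exact: mdist_ge0.
have cd : continuous d.
  apply: nonexpansive_continuous => x y; rewrite -lerBlDr; apply: le_d => a nAa.
  rewrite lerBlDr addrC; apply: (le_trans (d_le _ _ nAa)); exact: metric_triangle.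
exists (fun n x => Num.min 1 (n%:R * d x)); split.
- move=> n x; apply: (@continuous_min _ _ (cst 1) (fun y => n%:R * d y)).
    exact: cvg_cst.
  by apply: cvgM; [exact: cvg_cst | exact: cd].
- by move=> n x; rewrite le_min ler01 mulr_ge0.
- move=> x m n mn; rewrite le_min !ge_min lexx /=.
  by rewrite [X in _ || X]ler_wpM2r ?orbT // ler_nat.
move=> x; rewrite indicE; have [Ax|nAx] := pselect (A x); last first.
  rewrite memNset //.
  have -> : d x = 0 by apply/eqP; rewrite eq_le d0 -(mdistxx x) d_le.
  under eq_fun do rewrite mulr0 min_r //.
  exact: cvg_cst.
rewrite mem_set //.
have dx : 0 < d x.
  move: oA; rewrite openE => /(_ _ Ax).
  rewrite /interior -metricType_numDomainType.filter_from_mdist_nbhs => -[r /= r0 rA].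
  apply: (lt_le_trans r0); apply: le_d => a nAa; rewrite leNgt; apply/negP => ra.
  exact/nAa/rA.
apply: cvg_near_cst; near=> n; apply: min_l.
rewrite -ler_pdivrMr // mul1r.
by near: n; exact: nbhs_infty_ger.
Unshelve. all: by end_near. Qed.

End metric_functions.

Section borel_regularity.
Context {R : realType} {X : pmetricType R}.

(** By monotone convergence along approximations of indicators, both measures agree on open sets, a
    family closed under intersection that generates the Borel sets. *)
Lemma measure_eq_continuous (m1 m2 : {measure set (borel X) -> \bar R}) :
  (m1 setT < +oo)%E ->
  (forall f : X -> R, continuous f -> (forall x, 0 <= f x) ->
    (\int[m1]_(x in [set: borel X]) (f x)%:E =
     \int[m2]_(x in [set: borel X]) (f x)%:E)%E) ->
  forall A : set (borel X), measurable A -> m1 A = m2 A.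
Proof.
move=> m1oo m12.
apply: (@g_sigma_algebra_measure_unique _ R (borel X) (@open X) _ (fun=> setT)) => //.
- exact: sub_sigma_algebra.
- by move=> _; exact: openT.
- by rewrite bigcup_const //; exists 0%N.
- exact: openI.
move=> A oA; have mA : measurable (A : set (borel X)) by exact: sub_sigma_algebra.
have [f [cf f0 fnd fA]] := @open_indicator_limit R X A oA.
have mc (m : {measure set (borel X) -> \bar R}) :
  (\int[m]_(x in [set: borel X]) (f n x)%:E @[n --> \oo] --> m A)%E.
  have -> : m A = (\int[m]_(x in [set: borel X]) (\1_A x : R)%:E)%E.
    by rewrite integral_indic // setIT.
  have -> : (\int[m]_(x in [set: borel X]) (\1_A x : R)%:E)%E =
     (\int[m]_(x in [set: borel X]) limn (fun n => (f n x)%:E))%E.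
    apply: eq_integral => x _; apply/esym/cvg_lim => //.
    by apply: cvg_EFin; [near=> n | exact: fA].
  apply: cvg_monotone_convergence => //.
  - by move=> n; apply/measurable_EFinP; exact: continuous_measurable.
  - by move=> n x _; rewrite lee_fin.
  - by move=> x _ k n kn; rewrite lee_fin fnd.
have := mc m2; rewrite (_ : (fun n => _) =
   (fun n => \int[m1]_(x in [set: borel X]) (f n x)%:E)%E).
  by apply: cvg_unique (mc m1).
by apply/funext => n; rewrite m12.
Unshelve. all: by end_near. Qed.

End borel_regularity.

(** * Invariance of limits of empirical measures *)

Lemma homo_ltn_geq_id (k : nat -> nat) : {homo k : i j / (i < j)%N} ->
  forall i, (i <= k i)%N.
Proof. by move=> kinc; elim=> // i IH; apply: (leq_ltn_trans IH); exact: kinc. Qed.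

Section omega_hat_invariant.
Context {R : realType} {X : pmetricType R}.
Hypothesis compactX : compact [set: X].

(** The sum of [f - f \o T] along an orbit telescopes to two boundary terms, so its average vanishes
    in the limit; continuous functions then determine the measure. *)
Lemma omega_hat_invariant (T : X -> X) (x : X) : continuous T ->
  omega_hat T x `<=` invariant_measures T.
Proof.
move=> cT mu [k kinc kmu].
have mT := continuous_borel_measurable cT.
apply: (@measure_eq_continuous _ _
  (pushforward (mu : probability (borel X) R) (T : borel X -> borel X))) => //.
  rewrite [X in (X < _)%E](_ : _ = 1%E) ?ltry //.
  exact: (@probability_setT _ _ R (mu : probability (borel X) R)).
move=> f cf f0; have cfT : continuous (f \o T).
  by move=> y; apply: continuous_comp; [exact: cT | exact: cf].
have mf : measurable_fun [set: borel X] (EFin \o f).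
  by apply/measurable_EFinP; exact: continuous_measurable.
rewrite ge0_integral_pushforward //; last by move=> y _; rewrite lee_fin.
have fin g : continuous g ->
    (\int[mu : probability (borel X) R]_(y in [set: borel X]) (g y)%:E \is a fin_num)%E.
  by move=> cg; apply: integrable_fin_num => //; exact: continuous_integrable.
rewrite preimage_setT -[LHS]fineK; last exact: (fin (f \o T)).
rewrite -[RHS]fineK; last exact: fin.
congr EFin; rewrite -[LHS]/(mean mu (f \o T)) -[RHS]/(mean mu f).
move/weak_star_cvgP: kmu => kmu.
have [M fM] := compact_bounded_function compactX cf.
have k_ge := homo_ltn_geq_id kinc.
suff H : (fun i => mean (empirical_measure T x (k i)) f
   - mean (empirical_measure T x (k i)) (f \o T)) @ \oo --> (0 : R).
  have H' : (fun i => mean (empirical_measure T x (k i)) f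
    - mean (empirical_measure T x (k i)) (f \o T)) @ \oo
      --> mean mu f - mean mu (f \o T).
    by apply: cvgB; [exact: (kmu f cf) | exact: (kmu _ cfT)].
  have /eqP : mean mu f - mean mu (f \o T) = 0 by exact: cvg_unique H' H.
  by rewrite subr_eq0 => /eqP.
have cv : (fun i => 2 * M * i.+1%:R^-1) @ \oo --> (0 : R).
  rewrite -(mulr0 (2 * M)); apply: cvgM; first exact: cvg_cst.
  exact: cvg_harmonic.
apply: (@squeeze_cvgr _ _ _ _ (fun i => - (2 * M * i.+1%:R^-1))
  (fun i => 2 * M * i.+1%:R^-1)).
- near=> i; rewrite -ler_norml !mean_empirical //; last first.
    by move=> y; exact: f0.
  rewrite -mulrBr -sumrB.
  have -> : \sum_(j < (k i).+1) (f (iter j T x) - (f \o T) (iter j T x)) =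
     f x - f (iter (k i).+1 T x).
    elim: (k i) => [|n IH]; first by rewrite big_ord1.
    by rewrite big_ord_recr IH /=; ring.
  rewrite normrM ger0_norm ?invr_ge0 // mulrC ler_pM ?invr_ge0 //.
    apply: (le_trans (ler_normB _ _)).
    have := fM x; have := fM (iter (k i).+1 T x); lra.
  by rewrite lef_pV2 ?posrE ?ltr0n // ler_nat ltnS.
- by rewrite -[0]oppr0; exact: (cvgN cv).
- exact: cv.
Unshelve. all: by end_near. Qed.

End omega_hat_invariant.

(** * Test functions and sampling *)

Section separating_family.
Context {R : realType} {X : pmetricType R}.
Hypothesis compactX : compact [set: X].

Lemma compact_finite_net (e : R) : 0 < e ->
  exists c : seq X, forall x, exists2 a, a \in c & mdist a x < e.
Proof.
move=> e0; move: compactX; rewrite compact_cover.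
move=> /(_ X setT (fun a => (ball a e)°)) [].
- by move=> a _; exact: open_interior.
- by move=> x _; exists x => //; exact: nbhsx_ballx.
move=> c _ cX; exists (finmap.enum_fset c) => x.
have [a ac /interior_subset] := cX x I.
rewrite ballEmdist => ax; exists a => //.
Qed.

(** The [g j] form partitions of unity built on finite nets of mesh [n.+1%:R^-1]. Weighting them by
    the values of [f] at the net points averages [f] over nearby points, so the result is uniformly
    close to [f]. *)
Lemma separating_family : exists g : nat -> X -> R,
  [/\ forall j, continuous (g j), forall j x, 0 <= g j x <= 1 &
      forall (f : X -> R) (e : R), continuous f -> 0 < e ->
        exists s : seq (R * nat),
          forall x, `|f x - \sum_(p <- s) p.1 * g p.2 x| <= e].
Proof.
have /choice [c netP] : forall n : nat, exists c : seq X,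
    forall x, exists2 a, a \in c & mdist a x < n.+1%:R^-1.
  by move=> n; apply: compact_finite_net; rewrite invr_gt0.
pose b (n : nat) (a : X) (x : X) : R := Num.max 0 (n.+1%:R^-1 - mdist a x).
have b_ge0 n a x : 0 <= b n a x by rewrite le_max lexx.
have cb n a : continuous (b n a).
  move=> x; apply: (@continuous_max _ _ (cst 0) (fun y => n.+1%:R^-1 - mdist a y)).
    exact: cvg_cst.
  by apply: cvgB; [exact: cvg_cst | exact: continuous_mdist].
pose B n x := \sum_(a <- c n) b n a x.
have B_gt0 n x : 0 < B n x.
  have [a ac ax] := netP n x.
  rewrite /B (big_rem a) //= ltr_pwDl ?sumr_ge0 //.
  by rewrite lt_max subr_gt0 ax orbT.
have cB n : continuous (B n) by exact: continuous_sum.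
pose phi n a x := b n a x / B n x.
have cphi n a : continuous (phi n a).
  move=> x; apply: cvgM; first exact: cb.
  by apply: cvgV; [rewrite gt_eqF | exact: cB].
have phi_ge0 n a x : 0 <= phi n a x by rewrite divr_ge0 // ltW.
have phi_sum n x : \sum_(a <- c n) phi n a x = 1.
  by rewrite -mulr_suml -/(B n x) divff // gt_eqF.
(* The index [j] codes a net and a position in it; an index that codes none gives the zero
   function. *)
pose g (j : nat) : X -> R := if unpickle j is Some (n, i) then
  if (i < size (c n))%N then phi n (nth point (c n) i) else cst 0 else cst 0.
exists g; split.
- move=> j; rewrite /g; case: (unpickle j) => [[n i]|].
    by case: ifP => _; [exact: cphi | move=> x; exact: cvg_cst].
  by move=> x; exact: cvg_cst.
- move=> j x; rewrite /g; case: (unpickle j) => [[n i]|]; last by rewrite lexx ler01.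
  case: ifP => [ic|]; last by rewrite lexx ler01.
  rewrite phi_ge0 /= -(phi_sum n x) (big_rem (nth point (c n) i)) ?mem_nth //=.
  by rewrite lerDl sumr_ge0.
move=> f e cf e0; have [d d0 fd] := compact_uniform_continuity compactX cf e0.
have [n nd] : exists n : nat, n.+1%:R^-1 < d.
  exists (Num.trunc d^-1); rewrite invf_plt ?posrE //.
  exact: truncnS_gt.
exists [seq (f (nth point (c n) i), pickle (n, i)) | i <- iota 0 (size (c n))] => x.
rewrite big_map /=.
have -> : \sum_(i <- iota 0 (size (c n))) f (nth point (c n) i) * g (pickle (n, i)) x
   = \sum_(a <- c n) f a * phi n a x.
  rewrite [RHS](big_nth point) /index_iota subn0.
  rewrite !big_seq; apply: eq_bigr => i; rewrite mem_iota add0n => /= ic.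
  by rewrite /g pickleK ic.
rewrite -[f x]mulr1 -(phi_sum n x) mulr_sumr -sumrB.
apply: (le_trans (ler_norm_sum _ _ _)).
apply: (@le_trans _ _ (\sum_(a <- c n) e * phi n a x)); last first.
  by rewrite -mulr_sumr phi_sum mulr1.
apply: ler_sum => a _; rewrite -mulrBl normrM (ger0_norm (phi_ge0 _ _ _)).
have [ax|ax] := ltP (mdist a x) n.+1%:R^-1.
  by rewrite ler_wpM2r // fd // metric_sym (lt_trans ax).
by rewrite /phi /b max_l ?mul0r ?mulr0 // subr_le0.
Qed.

(** Three errors of e / 3: two from replacing [f] by a combination of the [g j], one from the means
    of that combination. Differences are considered, as neither sequence need converge. *)
Lemma mean_sub_cvg (g : nat -> X -> R) (mu nu : nat -> weak_star_probability X) :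
  (forall j, continuous (g j)) ->
  (forall (f : X -> R) (e : R), continuous f -> 0 < e ->
        exists s : seq (R * nat),
          forall x, `|f x - \sum_(p <- s) p.1 * g p.2 x| <= e) ->
  (forall j, mean (mu n) (g j) - mean (nu n) (g j) @[n --> \oo] --> 0) ->
  forall f, continuous f -> mean (mu n) f - mean (nu n) f @[n --> \oo] --> 0.
Proof.
move=> cg gdense munu f cf; apply/cvgrPdist_le => e e0.
have e3 : 0 < e / 3 by rewrite divr_gt0.
have [s fs] := gdense f _ cf e3.
pose l x := \sum_(p <- s) p.1 * g p.2 x.
have cp (p : R * nat) : continuous (fun x => p.1 * g p.2 x).
  by move=> x; apply: cvgM; [exact: cvg_cst | exact: cg].
have cl : continuous l by exact: continuous_sum.
have /cvgrPdist_le/(_ _ e3) :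
    mean (mu n) l - mean (nu n) l @[n --> \oo] --> (0 : R).
  under eq_fun => n.
    rewrite !mean_sum // -sumrB.
    under eq_bigr => p _ do rewrite !meanZ // -mulrBr.
    over.
  elim: (s) => [|p s' IH].
    by under eq_fun do rewrite big_nil; exact: cvg_cst.
  under eq_fun do rewrite big_cons.
  have H : p.1 * (mean (mu n) (g p.2) - mean (nu n) (g p.2)) @[n --> \oo] --> (0 : R).
    by rewrite -(mulr0 p.1); apply: cvgM; [exact: cvg_cst | exact: munu].
  by have := cvgD H IH; rewrite addr0; apply.
apply: filterS => n; rewrite !sub0r !normrN => H.
have Hm := @mean_dist_le _ _ compactX (mu n) f l _ cf cl fs.
have Hn := @mean_dist_le _ _ compactX (nu n) f l _ cf cl fs.
move: H Hm Hn; rewrite !ler_norml => /andP[? ?] /andP[? ?] /andP[? ?].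
by apply/andP; split; lra.
Qed.

(* Greedy choice: the inner product of the current error vector with
   [G x - mean mu G] has mean 0, so some [x] makes it at most 1 / 2 and the
   square of the error grows at most linearly with the size of the sample. *)
Lemma balanced_sample (mu : weak_star_probability X) (G : nat -> X -> R)
    (k n : nat) :
  (forall j, continuous (G j)) -> (forall j x, 0 <= G j x <= 1) ->
  exists2 s : seq X, size s = n &
    \sum_(j < k) (\sum_(x <- s) (G j x - mean mu (G j))) ^+ 2 <= (n * k.+1)%:R.
Proof.
move=> cG G01; elim: n => [|n [s sn IH]].
  exists [::] => //; rewrite mul0n big1 // => j _.
  by rewrite big_nil expr0n.
have c1 (c : R) : continuous (cst c : X -> R) by move=> x; exact: cvg_cst.
have m01 j : 0 <= mean mu (G j) <= 1 by exact: mean_ge0_le1.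
pose S j := \sum_(x <- s) (G j x - mean mu (G j)).
pose phi x := \sum_(j < k) S j * (G j x + - mean mu (G j)).
have cphi (j : 'I_k) : continuous (fun x => S j * (G j x + - mean mu (G j))).
  move=> x; apply: cvgM; first exact: cvg_cst.
  by apply: cvgD; [exact: cG | exact: cvg_cst].
have phi0 : mean mu phi = 0.
  rewrite /phi mean_sum //; apply: big1 => j _.
  rewrite meanZ //; last by move=> x; apply: cvgD; [exact: cG | exact: cvg_cst].
  rewrite (@meanD _ _ compactX mu (G j) (cst (- mean mu (G j)))) //.
  by rewrite mean_cst subrr mulr0.
(* If [phi] exceeded 1 / 2 everywhere, its mean would be at least 1 / 2. The slack avoids a strict
   inequality of integrals. *)
have [x phix] : exists x, phi x <= 1 / 2.
  apply: contrapT => /forallNP H.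
  have : mean mu (cst (1 / 2)) <= mean mu phi.
    apply: le_mean => //; first exact: continuous_sum.
    by move=> x; have /negP := H x; rewrite -ltNge => /ltW.
  by rewrite phi0 mean_cst; lra.
exists (x :: s); first by rewrite /= sn.
(* The cross terms add [2 * phi x], at most 1, and the new squares at most k; hence the factor
   [k.+1]. *)
have -> : \sum_(j < k) (\sum_(y <- x :: s) (G j y - mean mu (G j))) ^+ 2 =
   \sum_(j < k) S j ^+ 2 + 2 * phi x + \sum_(j < k) (G j x - mean mu (G j)) ^+ 2.
  rewrite /phi mulr_sumr -!big_split /=; apply: eq_bigr => j _.
  by rewrite big_cons -/(S j); ring.
have H : \sum_(j < k) (G j x - mean mu (G j)) ^+ 2 <= k%:R.
  apply: (@le_trans _ _ (\sum_(j < k) 1)); last by rewrite sumr_const card_ord.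
  apply: ler_sum => j _; rewrite -real_normK ?num_real // expr_le1 //.
  have := m01 j; have := G01 j x => /andP[? ?] /andP[? ?].
  by rewrite ler_norml; apply/andP; split; lra.
have {}IH : \sum_(j < k) S j ^+ 2 <= (n * k.+1)%:R by exact: IH.
have -> : (n.+1 * k.+1)%:R = (n * k.+1)%:R + k%:R + 1 :> R.
  by rewrite mulSn addnC natrD -addrA natr1.
lra.
Qed.

(** A balanced sample of size n errs by at most the square root of n * (k + 1), which is below d * n
    once n exceeds (k + 1) / d ^ 2. *)
Lemma sample_approximation (mu : weak_star_probability X) (G : nat -> X -> R)
    (k : nat) (d : R) :
  (forall j, continuous (G j)) -> (forall j x, 0 <= G j x <= 1) -> 0 < d ->
  exists2 s : seq X, (0 < size s)%N & forall j, (j < k)%N ->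
    `|\sum_(x <- s) (G j x - mean mu (G j))| <= d * (size s)%:R.
Proof.
move=> cG G01 d0; pose n := (Num.trunc (k.+1%:R / d ^+ 2)).+1.
have [s sn sP] := balanced_sample mu k n cG G01.
exists s; first by rewrite sn.
move=> j jk; rewrite -(@ler_pXn2r _ 2) ?nnegrE ?mulr_ge0 ?(ltW d0) //.
rewrite real_normK ?num_real //; apply: (@le_trans _ _ (n * k.+1)%:R).
  apply: le_trans sP; rewrite (bigD1 (Ordinal jk)) //= lerDl sumr_ge0 // => i _.
  exact: sqr_ge0.
rewrite sn exprMn natrM mulrC expr2 mulrA ler_wpM2r // -ler_pdivrMl ?mulr_gt0 //.
by rewrite mulrC ltW // truncnS_gt.
Qed.

End separating_family.

(** * Orbit segments *)

Section orbit_sums.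
Context {R : realType}.

(** A shift by one replaces one boundary term by another, at a cost of at most 1. This bounds the
    effect of moving the start of an orbit segment. *)
Lemma sum_shift_le (F : nat -> R) (N c : nat) : (forall m, 0 <= F m <= 1) ->
  `|\sum_(m < N) (F (m + c)%N - F m)| <= c%:R.
Proof.
move=> F01; elim: c => [|c IH].
  by rewrite big1 ?normr0 // => m _; rewrite addn0 subrr.
have -> : \sum_(m < N) (F (m + c.+1)%N - F m) =
   \sum_(m < N) (F (m + c)%N - F m) + (F (N + c)%N - F c).
  rewrite -(telescope_sumr (fun i => F (i + c)%N) (leq0n N)) big_mkord -big_split /=.
  by apply: eq_bigr => m _; rewrite addnS addSn; ring.
rewrite -natr1; apply: (le_trans (ler_normD _ _)); rewrite lerD //.
have /andP[? ?] := F01 (N + c)%N; have /andP[? ?] := F01 c.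
by rewrite ler_norml; apply/andP; split; lra.
Qed.

Lemma sum_mul (F : nat -> R) (n r : nat) :
  \sum_(i < n) \sum_(l < r) F (i * r + l)%N = \sum_(m < n * r) F m.
Proof.
elim: n => [|n IH]; first by rewrite mul0n !big_ord0.
by rewrite big_ord_recr IH mulSnr big_split_ord.
Qed.

End orbit_sums.

(* An item is a point together with a flag, raised when the next item need not
   be the image of this one; [chained] bars such a jump after the last item. *)
Section chained.
Context {A : Type}.
Implicit Types U V : seq (A * bool).

Definition chained (S : A -> A) U := forall d i, (i < size U)%N ->
  ~~ (nth d U i).2 ->
  (i.+1 < size U)%N /\ (nth d U i.+1).1 = S (nth d U i).1.

(** [chained] forces the last flag of [U] to be raised, so nothing links it to the start of [V]. *)
Lemma chained_cat S U V : chained S U -> chained S V -> chained S (U ++ V).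
Proof.
move=> cU cV d i; rewrite size_cat !nth_cat => iUV.
case: (ltnP i (size U)) => iU ni.
  have [h1 h2] := cU d i iU ni.
  by rewrite h1 (leq_trans h1) ?leq_addr.
have iV : (i - size U < size V)%N by rewrite ltn_subLR.
have [h1 h2] := cV d _ iV ni.
have -> : (i.+1 < size U)%N = false by apply/negbTE; rewrite -leqNgt leqW.
rewrite subSn //; split => //.
by rewrite -ltn_subLR ?subSn // leqW.
Qed.

Lemma chained_flatten S (s : seq (seq (A * bool))) :
  (forall U, List.In U s -> chained S U) -> chained S (flatten s).
Proof.
elim: s => [|U s IH] H /=; first by [].
apply: chained_cat; first by apply: H; left.
by apply: IH => V Vs; apply: H; right.
Qed.

Definition orbit_segment (S : A -> A) (n : nat) (x : A) : seq (A * bool) :=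
  mkseq (fun i => (iter i S x, i == n.-1)) n.

Lemma chained_orbit_segment S n x : chained S (orbit_segment S n x).
Proof.
move=> d i; rewrite size_mkseq => ni; rewrite nth_mkseq //= => in1.
have i1n : (i.+1 < n)%N.
  by rewrite ltn_neqAle ni andbT; apply: contra in1 => /eqP <-.
by rewrite nth_mkseq.
Qed.

End chained.

Section units.
Context {R : realType} {X : pmetricType R}.
Hypothesis compactX : compact [set: X].
Variables (T : X -> X) (r : nat) (D0 : set X).
Hypotheses (cT : continuous T) (r_gt0 : (0 < r)%N).
Hypothesis D0T : forall x, D0 x -> D0 (iter r T x).
Hypothesis reachD0 : forall x, exists2 c, (c <= r)%N & D0 (iter c T x).

(** Its sums along an orbit of [iter r T] are, up to the factor r, sums of [g] along an orbit of
    [T]. *)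
Definition period_mean (g : X -> R) (x : X) : R :=
  r%:R^-1 * \sum_(l < r) g (iter l T x).

Lemma continuous_iter n : continuous (iter n T).
Proof.
elim: n => [|n IH]; first by move=> x; exact: cvg_id.
by move=> x; apply: (@continuous_comp _ _ _ (iter n T) T); [exact: IH | exact: cT].
Qed.

Lemma continuous_comp_iter (g : X -> R) n : continuous g ->
  continuous (fun x => g (iter n T x)).
Proof.
move=> cg x; apply: (@continuous_comp _ _ _ (iter n T) g).
  exact: continuous_iter.
exact: cg.
Qed.

Lemma mean_iter mu (g : X -> R) n : invariant_measures T mu -> continuous g ->
  (forall x, 0 <= g x) -> mean mu (fun x => g (iter n T x)) = mean mu g.
Proof.
move=> muT cg g0; elim: n => [|n IH] //.
rewrite -IH -[RHS](@mean_invariant _ _ T mu) //; last exact: continuous_comp_iter.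
by congr mean; apply/funext => x /=; rewrite -iterSr.
Qed.

Lemma sum_orbit_segment (g : X -> R) n x :
  \sum_(p <- orbit_segment (iter r T) n x) period_mean g p.1 =
  r%:R^-1 * \sum_(m < n * r) g (iter m T x).
Proof.
rewrite -(big_mkseq (fun i => (iter i (iter r T) x, i == n.-1)) n
  (fun p => period_mean g p.1)) /= /period_mean -mulr_sumr.
rewrite -(sum_mul (fun m => g (iter m T x))).
congr (_ * _); apply: eq_bigr => i _; apply: eq_bigr => l _ /=.
by rewrite addnC iterD iterM.
Qed.

(** The unit is made of orbit segments of [iter r T], one for each point of a sample adapted to time
    averages of the [g j]; each segment starts where the orbit of its point reaches [D0]. *)
Lemma orbit_unit (mu : weak_star_probability X) (g : nat -> X -> R) (k : nat)
    (e : R) :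
  invariant_measures T mu ->
  (forall j, continuous (g j)) -> (forall j x, 0 <= g j x <= 1) -> 0 < e ->
  exists U : seq (X * bool), [/\ (0 < size U)%N,
    forall p, List.In p U -> D0 p.1, chained (iter r T) U,
    \sum_(p <- U) (p.2%:R : R) <= e * (size U)%:R &
    forall j, (j < k)%N ->
      `|\sum_(p <- U) (period_mean (g j) p.1 - mean mu (g j))|
      <= e * (size U)%:R].
Proof.
move=> muT cg g01 e0.
(* With n at least 2 / e, a cost of 1 per segment is at most e / 2 of its length. Both the flag and
   the shift into [D0] cost at most this. *)
have [n n_gt0 ne] : exists2 n : nat, (0 < n)%N & 1 <= e / 2 * n%:R.
  exists (Num.trunc (2 / e)).+1 => //.
  by rewrite -ler_pdivrMl ?divr_gt0 // mulr1 invf_div ltW // truncnS_gt.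
have nr_gt0 : 0 < (n * r)%:R :> R by rewrite ltr0n muln_gt0 n_gt0.
pose G j x := (n * r)%:R^-1 * \sum_(m < n * r) g j (iter m T x).
have cgi j m : continuous (fun x => g j (iter m T x)) by exact: continuous_comp_iter.
have cG j : continuous (G j).
  move=> x; apply: cvgM; first exact: cvg_cst.
  exact: (@continuous_sum _ _ _ _ (fun m : 'I_(n * r) => fun x => g j (iter m T x))).
have G01 j x : 0 <= G j x <= 1.
  apply/andP; split.
    rewrite mulr_ge0 ?invr_ge0 // sumr_ge0 // => m _.
    by have /andP[] := g01 j (iter m T x).
  rewrite ler_pdivrMl // mulr1; apply: (@le_trans _ _ (\sum_(m < n * r) (1 : R))).
    by apply: ler_sum => m _; have /andP[] := g01 j (iter m T x).
  by rewrite sumr_const card_ord.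
(* By invariance, passing to time averages does not change the mean. *)
have mG j : mean mu (G j) = mean mu (g j).
  rewrite /G meanZ //; last first.
    exact: (@continuous_sum _ _ _ _ (fun m : 'I_(n * r) => fun x => g j (iter m T x))).
  rewrite (@mean_sum _ _ compactX mu _ _
    (fun m : 'I_(n * r) => fun x => g j (iter m T x))) //.
  rewrite (eq_bigr (fun=> mean mu (g j))); last first.
    by move=> m _; apply: mean_iter => // x; have /andP[] := g01 j x.
  by rewrite sumr_const card_ord -[X in _ * X]mulr_natl mulKf // gt_eqF.
have e2 : 0 < e / 2 by rewrite divr_gt0.
have [s s0 sP] := @sample_approximation _ _ compactX mu G k _ cG G01 e2.
have /choice [c cP] : forall x, exists c, (c <= r)%N /\ D0 (iter c T x).
  by move=> x; have [c cr Dc] := reachD0 x; exists c.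
pose seg x := orbit_segment (iter r T) n (iter (c x) T x).
exists (flatten [seq seg x | x <- s]).
have size_seg x : size (seg x) = n by rewrite size_mkseq.
have size_U : size (flatten [seq seg x | x <- s]) = (size s * n)%N.
  by elim: (s) => //= x s' IH; rewrite size_cat IH size_seg mulSn.
have n0 : (0 : R) <= n%:R by [].
have sum_U (F : X * bool -> R) : \sum_(p <- flatten [seq seg x | x <- s]) F p =
    \sum_(x <- s) \sum_(p <- seg x) F p.
  elim: (s) => [|x s' IH]; first by rewrite !big_nil.
  by rewrite /= big_cat big_cons IH.
split.
- by rewrite size_U muln_gt0 s0.
- have D0i x i : D0 x -> D0 (iter i (iter r T) x).
    by move=> Dx; elim: i => // i IH; exact: D0T.
  elim: (s) => // x s' IH p /= /List.in_app_iff[|]; last exact: IH.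
  rewrite /seg /orbit_segment /mkseq.
  elim: (iota 0 n) => //= i t IHt [<-|] //=.
  by apply: D0i; have [] := cP x.
- apply: chained_flatten; elim: (s) => // x s' IH V /= [<-|]; last exact: IH.
  exact: chained_orbit_segment.
- rewrite sum_U size_U.
  have -> : \sum_(x <- s) \sum_(p <- seg x) (p.2%:R : R) = (size s)%:R.
    rewrite (eq_bigr (fun=> 1)); last first.
      move=> x _; rewrite -(big_mkseq
        (fun i => (iter i (iter r T) (iter (c x) T x), i == n.-1))
        n (fun p => p.2%:R)) /=.
      case: (n) n_gt0 => // n' _; rewrite big_ord_recr /= eqxx big1 ?add0r // => i _.
      by rewrite ltn_eqF.
    by rewrite sum_cst_seq mulr1.
  rewrite natrM mulrCA ler_peMr //; move: ne n0; nra.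
move=> j jk; rewrite sum_U size_U.
(* A shift by [c x], at most r, changes the sum of [n * r] values by at most r; the factor [r%:R^-1]
   turns this into 1. *)
have segE x : `|\sum_(p <- seg x) (period_mean (g j) p.1 - mean mu (g j))
    - n%:R * (G j x - mean mu (g j))| <= 1.
  rewrite sumrB sum_cst_seq size_seg sum_orbit_segment mulrBr opprB addrA subrK.
  have -> : n%:R * G j x = r%:R^-1 * \sum_(m < n * r) g j (iter m T x).
    rewrite /G natrM invfM !mulrA; congr (_ * _).
    by rewrite mulfV ?mul1r // pnatr_eq0 -lt0n.
  rewrite -mulrBr -sumrB normrM ger0_norm ?invr_ge0 // ler_pdivrMl ?ltr0n // mulr1.
  have := @sum_shift_le R (fun m => g j (iter m T x)) (n * r) (c x) (fun m => g01 j _).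
  under [X in `|X|]eq_bigr => m _ do rewrite iterD.
  by move=> /le_trans; apply; rewrite ler_nat; have [] := cP x.
have -> : \sum_(x <- s) \sum_(p <- seg x) (period_mean (g j) p.1 - mean mu (g j)) =
   \sum_(x <- s) (\sum_(p <- seg x) (period_mean (g j) p.1 - mean mu (g j))
    - n%:R * (G j x - mean mu (g j))) + n%:R * \sum_(x <- s) (G j x - mean mu (G j)).
  rewrite mulr_sumr -big_split /=; by apply: eq_bigr => x _; rewrite mG subrK.
apply: (le_trans (ler_normD _ _)).
have H1 := ler_norm_sum_size s segE.
have := sP j jk; rewrite normrM normr_nat natrM.
set v := `| _ |; set w := `| _ | in H1 *; move=> H2.
have : 0 <= (size s)%:R :> R by [].
move: H1 H2 ne n0; move: (size s)%:R n%:R => a b H1 H2 ne b0 a0.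
have ? : b * v <= b * (e / 2 * a) by rewrite ler_wpM2l.
have ? : a * 1 <= a * (e / 2 * b) by rewrite ler_wpM2l.
lra.
Qed.

End units.

(** * Following a sequence of invariant measures by one orbit *)

Section following.
Context {R : realType}.

(** Clears denominators and absorbs a shift of index: [arithmetic_mean u n] has n + 1 terms, the sum
    on the right has [N]. *)
Lemma arithmetic_mean_cvg0P (u : nat -> R) : (forall n, 0 <= u n) ->
  arithmetic_mean u @ \oo --> (0 : R) <->
  (forall e, 0 < e -> exists N0, forall N, (N0 <= N)%N ->
    \sum_(n < N) u n <= e * N%:R).
Proof.
move=> u0; have uE n : arithmetic_mean u n = n.+1%:R^-1 * \sum_(i < n.+1) u i.
  by rewrite /arithmetic_mean /= seriesEnat /= big_mkord.
have u_ge0 n : 0 <= arithmetic_mean u n.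
  by rewrite uE mulr_ge0 ?invr_ge0 // sumr_ge0.
split=> [/cvgrPdist_le cu e e0 | cu].
  have [N0 _ uN] := cu e e0; exists N0.+1 => -[//|N] NN.
  have := uN N NN; rewrite /= sub0r normrN ger0_norm // uE.
  by rewrite ler_pdivrMl ?ltr0n // mulrC.
apply/cvgrPdist_le => e e0; have [N0 uN] := cu e e0.
exists N0 => // n /= nN; rewrite sub0r normrN ger0_norm // uE.
by rewrite ler_pdivrMl ?ltr0n // mulrC uN // leqW.
Qed.

Lemma interval_index (b : nat -> nat) : (forall k, (k < b k)%N) ->
  {homo b : i j / (i < j)%N} ->
  exists q : nat -> nat, forall k N, (b k <= N < b k.+1)%N -> q N = k.
Proof.
move=> bk binc.
have bmono : {mono b : i j / (i <= j)%N} by exact: leq_mono.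
have /choice [q qP] : forall N, exists k, forall k', (b k' <= N < b k'.+1)%N -> k = k'.
  move=> N; have [[k kN]|nk] := pselect (exists k, (b k <= N < b k.+1)%N).
    exists k => k' /andP[k'N Nk']; have /andP[kN' Nk] := kN.
    apply/eqP; rewrite eqn_leq -ltnS -(leqW_mono bmono) (leq_ltn_trans kN' Nk') /=.
    by rewrite -ltnS -(leqW_mono bmono) (leq_ltn_trans k'N Nk).
  (* A default value for times before [b 0], which lie in no interval. *)
  by exists 0%N => k' k'N; case: nk; exists k'.
by exists q => k N; exact: qP.
Qed.

(** The largest k with [b k <= N] works; [k < b k] bounds such k by [N]. *)
Lemma interval_cover (b : nat -> nat) (K N : nat) : (forall k, (k < b k)%N) ->
  (b K <= N)%N -> exists2 k, (K <= k)%N & (b k <= N < b k.+1)%N.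
Proof.
move=> bk KN.
have ex : exists k, (K <= k)%N && (b k <= N)%N by exists K; rewrite leqnn.
have ub k : (K <= k)%N && (b k <= N)%N -> (k <= N)%N.
  by move=> /andP[_]; apply: leq_trans; exact: ltnW.
case: (ex_maxnP ex ub) => k /andP[Kk kN] kmax; exists k; rewrite ?kN //=.
rewrite ltnNge; apply/negP => h; have := kmax k.+1.
by rewrite (leqW Kk) h ltnn => /(_ isT).
Qed.

Context {X : pmetricType R}.
Hypothesis compactX : compact [set: X].
Variables (T : X -> X) (r : nat) (D0 : set X).
Hypotheses (cT : continuous T) (r_gt0 : (0 < r)%N).
Hypothesis D0T : forall x, D0 x -> D0 (iter r T x).
Hypothesis reachD0 : forall x, exists2 c, (c <= r)%N & D0 (iter c T x).
Hypothesis shadowD0 : asymptotic_average_shadowing D0 (iter r T).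

Lemma mdist_bounded : exists B : R, forall x y : X, mdist x y <= B.
Proof.
have [B BP] := compact_bounded_function compactX (@continuous_mdist R X point).
exists (B + B) => x y; apply: (le_trans (metric_triangle x point y)).
rewrite (metric_sym x point).
by apply: lerD; apply: (le_trans (ler_norm _) (BP _)).
Qed.

(** At points closer than [d], the values of [f] differ by at most e / 2; otherwise they differ by
    at most 2 * M, hence by at most 2 * M / d times the distance, whose average tends to 0. *)
Lemma shadowing_sum (f : X -> R) (S : X -> X) (y : nat -> X) (z : X) (e : R) :
  continuous f -> asymptotically_shadowed_in_average S y z -> 0 < e ->
  exists N0, forall N, (N0 <= N)%N ->
    `|\sum_(n < N) (f (iter n S z) - f (y n))| <= e * N%:R.
Proof.
move=> cf yz e0; have e2 : 0 < e / 2 by rewrite divr_gt0.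
have [d d0 fd] := compact_uniform_continuity compactX cf e2.
have [M fM] := compact_bounded_function compactX cf.
have M0 : 0 <= M by exact: (le_trans (normr_ge0 _) (fM point)).
have fdist u v : `|f u - f v| <= e / 2 + 2 * M / d * mdist u v.
  have [uv|uv] := ltP (mdist u v) d.
    rewrite -[leLHS]addr0; apply: lerD; first exact: fd.
    by rewrite !mulr_ge0 ?invr_ge0 ?mdist_ge0 // ltW.
  apply: (le_trans (ler_normB _ _)).
  have : 2 * M <= 2 * M / d * mdist u v.
    by rewrite -mulrA ler_peMr ?mulr_ge0 // ler_pdivlMl ?mulr1.
  have := fM u; have := fM v; lra.
(* The added 1 keeps the factor positive even if [M] is 0. *)
have C0 : 0 < 2 * M / d + 1 by rewrite ltr_pwDr // !mulr_ge0 ?invr_ge0 // ltW.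
have e' : 0 < e / 2 / (2 * M / d + 1) by rewrite divr_gt0.
have [N0 yzN] := (arithmetic_mean_cvg0P (fun n => mdist_ge0 _ _)).1 yz _ e'.
exists N0 => N /yzN H; apply: (le_trans (ler_norm_sum _ _ _)).
apply: (@le_trans _ _ (\sum_(n < N)
    (e / 2 + (2 * M / d + 1) * mdist (iter n S z) (y n)))).
  apply: ler_sum => n _; apply: (le_trans (fdist _ _)).
  by rewrite lerD2l ler_wpM2r ?mdist_ge0 // lerDl.
rewrite big_split /= sumr_const card_ord -mulr_sumr -mulr_natr.
have : (2 * M / d + 1) * \sum_(n < N) mdist (iter n S z) (y n) <= e / 2 * N%:R.
  by rewrite -ler_pdivlMl // mulrA [_^-1 * _]mulrC.
lra.
Qed.

(* [kappa n] is the index of the measure that is being followed at time [n]. *)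
Lemma follow_measures (g : nat -> X -> R) (nu : nat -> weak_star_probability X) :
  (forall j, continuous (g j)) -> (forall j x, 0 <= g j x <= 1) ->
  (forall k, invariant_measures T (nu k)) ->
  (forall j, mean (nu k.+1) (g j) - mean (nu k) (g j) @[k --> \oo] --> 0) ->
  exists z (kappa : nat -> nat),
  [/\ forall K, exists N0, forall n, (N0 <= n)%N -> (K <= kappa n)%N,
      forall k, exists2 n, (k <= n)%N & kappa n = k.+2 &
      forall j, mean (empirical_measure T z n) (g j) -
        mean (nu (kappa n)) (g j) @[n --> \oo] --> 0].
Proof.
move=> cg g01 nuT dnu.
have /choice [U UP] : forall k, exists U : seq (X * bool), [/\ (0 < size U)%N,
    forall p, List.In p U -> D0 p.1, chained (iter r T) U,
    \sum_(p <- U) (p.2%:R : R) <= k.+1%:R^-1 * (size U)%:R &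
    forall j, (j < k)%N ->
      `|\sum_(p <- U) (period_mean T r (g j) p.1 - mean (nu k) (g j))|
      <= k.+1%:R^-1 * (size U)%:R].
  by move=> k; apply: orbit_unit => //; rewrite invr_gt0.
(* Quantity 0 is the flag, with target 0: the density of jumps is controlled like the means, whose
   indices move up by one. *)
pose h j (p : X * bool) : R :=
  if j is j'.+1 then period_mean T r (g j') p.1 else p.2%:R.
pose a k j := if j is j'.+1 then mean (nu k) (g j') else 0.
have m01 mu j : 0 <= mean mu (g j) <= 1 by exact: mean_ge0_le1.
have pm01 j x : 0 <= period_mean T r (g j) x <= 1.
  rewrite /period_mean mulr_ge0 ?invr_ge0 ?sumr_ge0 //=; last first.
    by move=> l _; have /andP[] := g01 j (iter l T x).
  rewrite ler_pdivrMl ?ltr0n // mulr1.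
  apply: (@le_trans _ _ (\sum_(l < r) (1 : R))); last by rewrite sumr_const card_ord.
  by apply: ler_sum => l _; have /andP[] := g01 j (iter l T x).
have cpm j : continuous (period_mean T r (g j)).
  move=> x; apply: cvgM; first exact: cvg_cst.
  apply: (@continuous_sum _ _ _ _ (fun (l : 'I_r) x => g j (iter l T x))) => l.
  exact: continuous_comp_iter.
have U_gt0 k : (0 < size (U k))%N by have [] := UP k.
have ha j p k : `|h j p - a k j| <= 1.
  case: j => [|j] /=; first by rewrite subr0 normr_nat; case: p.2.
  have /andP[? ?] := m01 (nu k) j; have /andP[? ?] := pm01 j p.1.
  by rewrite ler_norml; apply/andP; split; lra.
have Ua k j : (j <= k)%N ->
    `|\sum_(p <- U k) (h j p - a k j)| <= k.+1%:R^-1 * (size (U k))%:R.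
  have [_ _ _ flagU meanU] := UP k.
  case: j => [_|j jk] /=; last exact: meanU.
  under eq_bigr do rewrite subr0.
  by rewrite ger0_norm // sumr_ge0.
have [y [b [bk binc yU yb]]] := @slow_concatenation _ _ U h a U_gt0 ha Ua.
have [q qP] := interval_index bk binc.
have q_ge K N : (b K <= N)%N -> (K <= q N)%N.
  by move=> /(interval_cover bk)[k Kk kN]; rewrite (qP k N).
have da j : a k.+1 j - a k j @[k --> \oo] --> 0.
  case: j => [|j]; last exact: dnu.
  by rewrite /= subr0; exact: cvg_cst.
(* Between [b k] and [b k.+1] the unit being repeated is [U k.+1], hence the target of index
   [(q N).+1]. [K] makes the change of target and the other error each at most e / 2, and puts [h j]
   among the controlled quantities. *)
have est j e : 0 < e -> exists N0, forall N, (N0 <= N)%N ->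
    `|\sum_(n < N) (h j (y n) - a (q N).+1 j)| <= e * N%:R.
  move=> e0; have e2 : 0 < e / 2 by rewrite divr_gt0.
  have /cvgrPdist_le/(_ _ e2)[K1 _ daK] := da j.
  pose K2 := Num.trunc (8 / e); pose K := maxn K1 (maxn K2 j).
  exists (b K.+1) => N /(interval_cover bk)[[//|k]]; rewrite ltnS => Kk kN.
  have /andP[bN Nb] := kN; rewrite (qP _ _ kN).
  move: Kk; rewrite !geq_max => /and3P[K1k K2k jk].
  apply: (le_trans (yb k j N _ _)); first exact: leqW.
    by rewrite bN ltnW.
  rewrite ler_wpM2r // [leRHS]splitr lerD //; last first.
    by have := daK k.+1 (leqW K1k); rewrite /= sub0r normrN.
  rewrite ler_pdivrMr ?ltr0n //.
  have : 8 / e < K2.+1%:R by exact: truncnS_gt.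
  rewrite ltr_pdivrMr // => H8.
  have : K2.+1%:R * e <= k.+2%:R * e by rewrite ler_wpM2r ?(ltW e0) // ler_nat ltnW.
  lra.
(* Time n lies inside the prefix of length [b n.+1], which consists of complete units. *)
have y_struct n : D0 (y n).1 /\ (~~ (y n).2 -> (y n.+1).1 = iter r T (y n).1).
  have [t yt] := yU n.+1; have bn := ltnW (bk n.+1).
  have chU : chained (iter r T) (flatten [seq U i | i <- t]).
    apply: chained_flatten; elim: (t) => // i t' IH V /= [<-|]; last exact: IH.
    by have [] := UP i.
  have DU p : List.In p (flatten [seq U i | i <- t]) -> D0 p.1.
    elim: (t) => // i t' IH /= /List.in_app_iff[|]; last exact: IH.
    by have [_ H _ _ _] := UP i; exact: H.
  rewrite -yt in chU DU; split.
    apply: DU; rewrite /mkseq.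
    have : n \in iota 0 (b n.+1) by rewrite mem_iota.
    elim: (iota _ _) => //= i t' IH; rewrite inE => /predU1P[->|nt]; first by left.
    by right; exact: IH.
  move=> yn; have := chU (y 0%N) n; rewrite size_mkseq nth_mkseq // => /(_ bn yn).
  by move=> [h1]; rewrite nth_mkseq.
have [B mB] := mdist_bounded.
have B0 : 0 <= B by exact: le_trans (mdist_ge0 _ _) (mB point point).
(* Jumps occur only at raised flags, which have density zero, and each is bounded by [B]. *)
have pseudo : asymptotic_average_pseudoorbit (iter r T) (fun n => (y n).1).
  apply/arithmetic_mean_cvg0P => [n|e e0]; first exact: mdist_ge0.
  have B1 : 0 < B + 1 by rewrite ltr_wpDl.
  have [N0 flagN] := est 0%N (e / (B + 1)) ltac:(by rewrite divr_gt0).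
  exists N0 => N /flagN; under eq_bigr do rewrite subr0.
  rewrite ger0_norm ?sumr_ge0 // => H.
  apply: (@le_trans _ _ ((B + 1) * \sum_(n < N) h 0%N (y n))); last first.
    by rewrite -ler_pdivlMl // mulrA [_^-1 * _]mulrC.
  rewrite mulr_sumr; apply: ler_sum => n _; have [_] := y_struct n.
  rewrite /h; case: (y n).2 => [_|/(_ isT) ->].
    by rewrite mulr1 (le_trans (mB _ _)) // lerDl.
  by rewrite mulr0 mdistxx.
have [z Dz zy] := shadowD0 (fun n => (y_struct n).1) pseudo.
(* The empirical measure of index n has n + 1 terms, that is [n.+1 %/ r] full periods and a
   remainder. *)
exists z, (fun n => (q (n.+1 %/ r)%N).+1); split.
- move=> K; exists (b K * r)%N => n bn; apply: leqW; apply: q_ge.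
  by rewrite leq_divRL // ltnW.
- move=> k; have b1 : (0 < b k.+1 * r)%N by rewrite muln_gt0 (leq_trans _ (bk _)).
  (* At this time exactly [b k.+1] periods are complete, so [q] takes the value [k.+1]. *)
  exists (b k.+1 * r).-1; last first.
    by rewrite prednK // mulnK // (qP k.+1) // leqnn binc.
  rewrite -ltnS prednK // (leq_trans (ltnW (bk k.+1))) // leq_pmulr //.
move=> j; apply/cvgrPdist_le => e e0.
(* Shadowing and concatenation each cost e / 4; the incomplete last period, of fewer than r terms,
   costs at most e / 2 by the choice of [N3]. *)
have e4 : 0 < e / 4 by rewrite divr_gt0.
have [N1 estN] := est j.+1 _ e4.
have [N2 shN] := shadowing_sum (cpm j) zy e4.
pose N3 := Num.trunc (2 * r%:R / e).
exists (maxn N3 (maxn N1 N2 * r)) => // n /=.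
rewrite geq_max => /andP[N3n Nn].
have : (maxn N1 N2 <= n.+1 %/ r)%N by rewrite leq_divRL // leqW.
rewrite geq_max => /andP[/estN H1 /shN H2].
set N := (n.+1 %/ r)%N in H1 H2 *.
set m := mean (nu _) _.
rewrite sub0r normrN mean_empirical //; last by move=> x; have /andP[] := g01 j x.
have -> : n.+1%:R^-1 * \sum_(i < n.+1) g j (iter i T z) - m =
    n.+1%:R^-1 * \sum_(i < n.+1) (g j (iter i T z) - m).
  by rewrite sumrB sumr_const card_ord mulrBr -[m *+ _]mulr_natl mulKf //.
rewrite normrM ger0_norm ?invr_ge0 // ler_pdivrMl ?ltr0n //.
pose F i := g j (iter i T z) - m.
have -> : \sum_(i < n.+1) (g j (iter i T z) - m) =
    \sum_(i < N * r) F i + \sum_(i < n.+1 %% r) F (N * r + i)%N.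
  have splitF p p' : \sum_(i < p) F i + \sum_(i < p') F (p + i)%N =
    \sum_(i < p + p') F i by rewrite big_split_ord.
  by rewrite splitF -divn_eq.
have F1 i : `|F i| <= 1.
  have /andP[? ?] := m01 (nu (q N).+1) j.
  have /andP[? ?] := g01 j (iter i T z).
  by rewrite ler_norml /F; apply/andP; split; rewrite /m; lra.
have r0 : 0 <= r%:R :> R by [].
have Frest : `|\sum_(i < n.+1 %% r) F (N * r + i)%N| <= r%:R.
  apply: (le_trans (ler_norm_sum _ _ _)).
  apply: (@le_trans _ _ (\sum_(i < n.+1 %% r) (1 : R))); first exact: ler_sum.
  by rewrite sumr_const card_ord ler_nat ltnW // ltn_pmod.
have Fmain : `|\sum_(i < N * r) F i| <= r%:R * (e / 2 * N%:R).
  have -> : \sum_(i < N * r) F i =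
      r%:R * \sum_(i < N) (period_mean T r (g j) (iter i (iter r T) z) - m).
    rewrite -sum_mul mulr_sumr; apply: eq_bigr => i _.
    rewrite sumrB sumr_const card_ord mulrBr [_ * m]mulr_natl; congr (_ - _).
    rewrite /period_mean mulVKf ?pnatr_eq0 -?lt0n //.
    by apply: eq_bigr => l _; rewrite addnC iterD iterM.
  rewrite normrM normr_nat ler_wpM2l //.
  have -> : \sum_(i < N) (period_mean T r (g j) (iter i (iter r T) z) - m) =
     \sum_(i < N) (period_mean T r (g j) (iter i (iter r T) z)
       - period_mean T r (g j) (y i).1) +
     \sum_(i < N) (h j.+1 (y i) - m).
    by rewrite -big_split /=; apply: eq_bigr => i _; rewrite addrA subrK.
  apply: (le_trans (ler_normD _ _)).
  move: H1 H2; rewrite -/m; lra.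
apply: (le_trans (ler_normD _ _)).
have Nr : (N * r)%:R <= n.+1%:R :> R by rewrite ler_nat leq_divM.
have : 2 * r%:R / e < N3.+1%:R by exact: truncnS_gt.
rewrite ltr_pdivrMr // => H3.
have H4 : N3.+1%:R * e <= n.+1%:R * e by rewrite ler_wpM2r ?(ltW e0) // ler_nat.
have H5 : (N * r)%:R * e <= n.+1%:R * e by rewrite ler_wpM2r ?(ltW e0).
move: H5; rewrite natrM; move: Fmain Frest; lra.
Qed.

End following.

(** * Walks in connected sets *)

Section dense_walk.
Context {R : realType} {Y : topologicalType} (I : nat -> Y -> R).
Hypothesis cI : forall j, continuous (I j).

Definition gap (n : nat) (u v : Y) : R := \sum_(j < n) `|I j u - I j v|.

(** One parameter governs both the number of functions compared and the tolerance, so the relations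
    get finer as n grows and eventually control every [I j]. *)
Definition step (n : nat) : rel Y := fun u v => gap n u v < n.+1%:R^-1.

Lemma step_refl n : reflexive (step n).
Proof.
by move=> u; rewrite /step /gap big1 ?invr_gt0 // => j _; rewrite subrr normr0.
Qed.

Lemma step_sym n : symmetric (step n).
Proof.
by move=> u v; rewrite /step /gap; under eq_bigr do rewrite distrC.
Qed.

Lemma step_mono m n u v : (m <= n)%N -> step n u v -> step m u v.
Proof.
move=> mn; rewrite /step => uv.
apply: (@le_lt_trans _ _ (gap n u v)); last first.
  by apply: (lt_le_trans uv); rewrite lef_pV2 ?posrE ?ltr0n // ler_nat.
rewrite /gap -(subnKC mn) big_split_ord lerDl sumr_ge0 //.
Qed.

Lemma step_lt m n u v j : (j < n)%N -> (m <= n)%N -> step n u v ->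
  `|I j u - I j v| < m.+1%:R^-1.
Proof.
move=> jn mn /lt_le_trans H.
apply: (@le_lt_trans _ _ (gap n u v)).
  by rewrite /gap (bigD1 (Ordinal jn)) //= lerDl sumr_ge0.
by apply: H; rewrite lef_pV2 ?posrE ?ltr0n // ler_nat.
Qed.

Lemma open_step n u : open [set v | step n u v].
Proof.
have cgap : continuous (gap n u).
  apply: (@continuous_sum R _ _ _ (fun (j : 'I_n) v => `|I j u - I j v|)) => j v.
  by apply: cvg_norm; apply: cvgB; [exact: cvg_cst | exact: cI].
rewrite [X in open X](_ : _ = gap n u @^-1` [set x | x < n.+1%:R^-1]) //.
by apply: open_comp => [v _|]; [exact: cgap | exact: open_lt].
Qed.

Variable V : set Y.
Hypothesis connectedV : connected V.

(** The points reachable from [u] by steps inside [V] form a relatively open set, which is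
    relatively closed because [step] is symmetric; by connectedness it is all of [V]. *)
Lemma connected_path n u v : V u -> V v ->
  exists s, [/\ all (fun w => `[< V w >]) s, path (step n) u s & last u s = v].
Proof.
move=> Vu Vv.
pose B := [set v | V v /\ exists s,
  [/\ all (fun w => `[< V w >]) s, path (step n) u s & last u s = v]].
suff BV : B = V by have [] : B v by rewrite BV.
have B_step b v' : B b -> V v' -> step n b v' -> B v'.
  move=> [Vb [s [Vs us sb]]] Vv' bv'; split=> //; exists (rcons s v').
  rewrite all_rcons Vs andbT rcons_path us sb last_rcons; split=> //.
  exact/asboolP.
have open_nbhd (A : set Y) : open (\bigcup_(b in A) [set v' | step n b v']).
  by apply: bigcup_open => b _; exact: open_step.
apply: connectedV.
- by exists u; split=> //; exists [::].
- exists (\bigcup_(b in B) [set v' | step n b v']) => //.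
  apply/seteqP; split=> [w Bw|w [Vw [b Bb /= bw]]]; last exact: B_step Bb Vw bw.
  by split; [case: Bw | exists w => //=; exact: step_refl].
exists (~` \bigcup_(b in V `\` B) [set v' | step n b v']).
  exact: open_closedC.
apply/seteqP; split=> [w Bw|w [Vw /= nw]].
  split; first by case: Bw.
  by move=> [b [Vb nBb] /= bw]; apply/nBb/(B_step w); rewrite // step_sym.
by apply: contrapT => nBw; apply: nw; exists w => //=; exact: step_refl.
Qed.

(** Each point of [ws] gets an excursion from [v0] and back. Returning to [v0] lets loops of
    different n be joined. *)
Lemma connected_loop n (v0 : Y) (ws : seq Y) : V v0 ->
  all (fun w => `[< V w >]) ws -> exists s,
  [/\ all (fun w => `[< V w >]) s, path (step n) v0 s, last v0 s = v0 &
      {subset ws <= v0 :: s}].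
Proof.
move=> Vv0; elim: ws => [|w ws IH] /=; first by exists [::].
move=> /andP[/asboolP Vw /IH [s [Vs v0s sv0 wss]]].
have [s1 [Vs1 p1 l1]] := connected_path n Vv0 Vw.
have [s2 [Vs2 p2 l2]] := connected_path n Vw Vv0.
exists (s1 ++ s2 ++ s); rewrite !all_cat Vs Vs1 Vs2 !cat_path p1 l1 p2 l2 v0s.
rewrite !last_cat l1 l2 sv0; split=> // x; rewrite inE => /predU1P[->|/wss].
  by rewrite -cat_cons mem_cat -l1 mem_last.
by rewrite !inE !mem_cat => /orP[->|->]; rewrite ?orbT.
Qed.

Hypothesis I01 : forall j v, 0 <= I j v <= 1.

(** The box of a grid of mesh 1 / (n + 1) that contains the first n + 1 values; the value 1 calls
    for one more index, hence [n.+2]. *)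
Definition cell (n : nat) (v : Y) : {ffun 'I_n.+1 -> 'I_n.+2} :=
  [ffun j : 'I_n.+1 => inord (Num.trunc (n.+1%:R * I j v))].

Lemma cell_close n u v j : (j <= n)%N -> cell n u = cell n v ->
  `|I j u - I j v| <= n.+1%:R^-1.
Proof.
move=> jn /ffunP /(_ (Ordinal (n:=n.+1) jn)); rewrite !ffunE /=.
have bnd w : (Num.trunc (n.+1%:R * I j w) < n.+2)%N.
  rewrite ltnS truncn_le_nat; have /andP[_ w1] := I01 j w.
  apply: (@le_lt_trans _ _ n.+1%:R); first by rewrite ler_piMr.
  by rewrite ltr_nat.
move=> /(congr1 val); rewrite /= !inordK // => uv.
have trP w := @truncn_itv R (n.+1%:R * I j w)
  ltac:(by rewrite mulr_ge0 //; have /andP[] := I01 j w).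
rewrite -[leRHS]mulr1 -ler_pdivrMl ?invr_gt0 ?ltr0n // invrK.
rewrite -[X in X * _]ger0_norm // -normrM mulrBr.
have := trP u; have := trP v; rewrite uv -natr1.
by move=> /andP[? ?] /andP[? ?]; rewrite ler_norml; apply/andP; split; lra.
Qed.

(** There are finitely many cells, and one point of [V] from each cell that [V] meets suffices; the
    other cells get the default [v0]. *)
Lemma finite_net n : V !=set0 -> exists ws : seq Y,
  all (fun w => `[< V w >]) ws /\
  forall v, V v -> exists2 w, w \in ws &
    forall j, (j <= n)%N -> `|I j w - I j v| <= n.+1%:R^-1.
Proof.
move=> [v0 Vv0].
have /choice [rep repP] : forall c, exists u, V u /\
    (forall v, V v -> cell n v = c -> cell n u = c).
  move=> c; have [[v [Vv vc]]|nv] := pselect (exists v, V v /\ cell n v = c).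
    by exists v.
  by exists v0; split=> // v Vv vc; case: nv; exists v.
exists [seq rep c | c <- enum {ffun 'I_n.+1 -> 'I_n.+2}]; split=> [|v Vv].
  by rewrite all_map; apply/allP => c _ /=; apply/asboolP; have [] := repP c.
exists (rep (cell n v)); first by rewrite map_f ?mem_enum.
move=> j jn; apply: cell_close => //.
by have [_ /(_ v Vv erefl)] := repP (cell n v).
Qed.

(* The walk visits a finite net of mesh 1 / (n + 1) before the mesh is refined. *)
Lemma dense_walk : V !=set0 -> exists w : nat -> Y,
  [/\ forall k, V (w k),
      forall j, I j (w k.+1) - I j (w k) @[k --> \oo] --> (0 : R) &
      forall v J K, V v -> exists2 k, (K <= k)%N &
        forall j, (j <= J)%N -> `|I j (w k) - I j v| <= J.+1%:R^-1].
Proof.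
move=> V0; have [v0 Vv0] := V0.
have /choice [ws wsP] := finite_net^~ V0.
have /choice [s sP] : forall n, exists s,
  [/\ all (fun w => `[< V w >]) s, path (step n) v0 s, last v0 s = v0 &
    {subset ws n <= v0 :: s}].
  by move=> n; apply: connected_loop => //; have [] := wsP n.
pose L k := flatten (mkseq (fun n => v0 :: s n) k.+1).
have L0 : L 0%N = v0 :: s 0%N by rewrite /L /= cats0.
have LS k : L k.+1 = L k ++ (v0 :: s k.+1).
  by rewrite /L /mkseq -{1}(addn1 k.+1) iotaD map_cat flatten_cat /= cats0.
have sizeL k : (k < size (L k))%N.
  elim: k => [|k IH]; first by rewrite L0.
  by rewrite LS size_cat /= addnS ltnS (leq_trans IH) // leq_addr.
(* After [L K] only loops of index above [K] follow. Each starts with [v0], where the preceding one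
   ended, so the joints are trivial steps. *)
have Ltail K m : exists p, L (K + m)%N = L K ++ p /\
    path (step K) v0 p /\ last v0 p = v0.
  elim: m => [|m [p [Lp [pp lp]]]].
    by exists [::]; rewrite addn0 cats0.
  exists (p ++ (v0 :: s (K + m).+1)); rewrite addnS LS Lp catA; split=> //.
  rewrite cat_path pp lp /= step_refl /= last_cat /=.
  have [_ ps ls _] := sP (K + m).+1; split=> //.
  apply: sub_path ps => u v; apply: step_mono.
  by rewrite (leq_trans (leq_addr m K)).
have [w wL] : exists w : nat -> Y, forall k, mkseq w (size (L k)) = L k.
  by apply: sequence_of_prefixes => // k; exists (v0 :: s k.+1).
have w_nth k i : (i < size (L k))%N -> w i = nth v0 (L k) i.
  by move=> ik; rewrite -wL nth_mkseq.
exists w; split.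
- move=> k; rewrite (w_nth k) ?sizeL //.
  have : all (fun u => `[< V u >]) (L k).
    have allC n : all (fun u => `[< V u >]) (v0 :: s n).
      by have [Vs _ _ _] := sP n; rewrite /= Vs andbT; exact/asboolP.
    by elim: (k) => [|k' IH]; rewrite ?L0 // LS all_cat IH allC.
  by move=> /(all_nthP v0) /(_ k (sizeL k)) /asboolP.
- move=> j; apply/cvgrPdist_le => e e0.
  (* [K] is at least [K0], so that steps are below e, and exceeds j, so that [I j] is among the
     functions compared. *)
  pose K0 := Num.trunc e^-1; pose K := maxn K0 j.+1.
  exists (size (L K)) => // m /= Km; rewrite sub0r normrN.
  have mL : (m.+1 < size (L (K + m)))%N.
    have K1 : (0 < K)%N by rewrite leq_max orbT.
    by rewrite (leq_trans _ (sizeL _)) // ltnS -[X in (X <= _)%N]add1n leq_add2r.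
  have [p [Lp [/(pathP v0) pp _]]] := Ltail K m.
  rewrite !(w_nth (K + m)%N) ?(ltnW mL) // Lp !nth_cat ltnNge (leqW Km) /= ltnNge Km /=.
  rewrite subSn // distrC.
  have mp : ((m - size (L K)).+1 < size p)%N.
    by rewrite -subSn // ltn_subLR ?(leqW Km) // -size_cat -Lp.
  apply/ltW/(lt_trans (@step_lt K0 K _ _ j _ _ (pp _ mp))).
  + by rewrite /K leq_max ltnSn orbT.
  + by rewrite leq_maxl.
  by rewrite invf_plt ?posrE // truncnS_gt.
move=> v J K Vv; pose n := maxn J K.
have [_ /(_ v Vv) [u uws uv]] := wsP n.
have [_ _ _ /(_ u uws) /(nthP v0) [i iN iE]] := sP n.
(* For positive n, the loop of index n starts after [L n.-1], which has at least n entries, so this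
   visit to [u] occurs at time n or later. *)
have [k [kn wk]] : exists k, (n <= k)%N /\ w k = u.
  case: (posnP n) => [n0|n_gt0].
    exists i; rewrite n0; split=> //.
    by rewrite (w_nth 0%N) L0 -n0.
  exists (size (L n.-1) + i)%N; split.
    by rewrite -{1}(prednK n_gt0) (leq_trans (sizeL _)) // leq_addr.
  have Ln : L n = L n.-1 ++ (v0 :: s n) by rewrite -{1 3}(prednK n_gt0) LS.
  rewrite (w_nth n) Ln; last by rewrite size_cat ltn_add2l.
  by rewrite nth_cat ltnNge leq_addr /= addKn.
exists k; first by rewrite (leq_trans _ kn) // leq_maxr.
move=> j jJ; rewrite wk; apply: (@le_trans _ _ n.+1%:R^-1).
  by apply: uv; rewrite (leq_trans jJ) // leq_maxl.
by rewrite lef_pV2 ?posrE ?ltr0n // ler_nat ltnS leq_maxl.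
Qed.

End dense_walk.

(** * Limit sets of empirical measures *)

Section assembly.
Context {R : realType} {X : pmetricType R}.

Lemma continuous_mean (f : X -> R) : continuous f ->
  continuous ((@mean R X)^~ f).
Proof.
move=> cf mu; have /weak_star_cvgP H : nbhs mu --> mu by exact: cvg_id.
exact: H.
Qed.

Lemma weak_star_cvg_sub (mu nu : nat -> weak_star_probability X)
    (l : weak_star_probability X) :
  (forall f : X -> R, continuous f ->
     mean (mu n) f - mean (nu n) f @[n --> \oo] --> (0 : R)) ->
  nu n @[n --> \oo] --> l -> mu n @[n --> \oo] --> l.
Proof.
move=> munu /weak_star_cvgP nul; apply/weak_star_cvgP => f cf.
suff : (fun n => mean (mu n) f - mean (nu n) f + mean (nu n) f) @ \oo
    --> (0 + mean l f : R).
  by rewrite add0r; under eq_fun do rewrite subrK.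
by apply: cvgD; [exact: munu | exact: nul].
Qed.

Lemma homo_ltn_cvg_oo (k : nat -> nat) : {homo k : i j / (i < j)%N} ->
  k @ \oo --> \oo.
Proof.
move=> /homo_ltn_geq_id kge A [N _ NA]; exists N => // i /= Ni; apply: NA => /=.
exact: leq_trans (kge i).
Qed.

Lemma rpd_iter (T : X -> X) (r : nat) (D : 'I_r -> set X) (c : nat) (i : 'I_r) x :
  regular_periodic_decomposition T D -> D i x ->
  D (iter c (@ordS r) i) (iter c T x).
Proof.
move=> rpdD Dx; elim: c => //= c IH.
by apply: (rpd_image rpdD); exists (iter c T x).
Qed.

Lemma iter_ordS (r c : nat) (i : 'I_r) :
  iter c (@ordS r) i = ((i + c) %% r)%N :> nat.
Proof.
elim: c => [|c IH]; first by rewrite addn0 modn_small.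
by rewrite iterS /= IH -addn1 modnDml addn1 addnS.
Qed.

End assembly.

Theorem theorem21 (R : realType) (X : pmetricType R) (T : X -> X)
    (r : nat) (D : 'I_r -> set X) (r_gt0 : (0 < r)%N) :
  compact [set: X] -> continuous T ->
  regular_periodic_decomposition T D ->
  asymptotic_average_shadowing (D (Ordinal r_gt0)) (iter r T) ->
  (forall V : set (weak_star_probability X),
     V `<=` invariant_measures T -> V !=set0 ->
     closed (V : set (subspace (invariant_measures T))) -> connected V ->
     exists x : X, omega_hat T x = V) /\
  (forall mu : weak_star_probability X, invariant_measures T mu ->
     exists x : X, generic_point T mu x).
Proof.
move=> compactX cT rpdD shD; set D0 := D _ in shD.
have D0T x : D0 x -> D0 (iter r T x).
  move=> D0x; have := @rpd_iter _ _ _ _ _ r _ _ rpdD D0x.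
  by congr (D _ _); apply: val_inj; rewrite /= iter_ordS add0n modnn.
(* From [D i], r - i steps lead to [D0]. *)
have reach x : exists2 c, (c <= r)%N & D0 (iter c T x).
  have : [set: X] x by [].
  rewrite -(rpd_cover rpdD) => -[i _ Dx].
  exists (r - i)%N; first exact: leq_subr.
  have := @rpd_iter _ _ _ _ _ (r - i) _ _ rpdD Dx.
  by congr (D _ _); apply: val_inj; rewrite /= iter_ordS subnKC ?modnn // ltnW.
have [g [cg g01 gdense]] := separating_family compactX.
have follow nu :=
  @follow_measures _ _ compactX T r D0 cT r_gt0 D0T reach shD g nu cg g01.
have lift mu nu := @mean_sub_cvg _ _ compactX g mu nu cg gdense.
split=> [V Vinv V0 Vclosed Vconn|mu muT]; last first.
  (* Following a constant sequence makes the whole sequence of empirical measures converge. *)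
  have [|z [kappa [_ _ zmu]]] := follow (fun=> mu) (fun=> muT).
    by move=> j; rewrite subrr; exact: cvg_cst.
  exists z; apply: (@weak_star_cvg_sub _ _ _ (fun=> mu)); first exact: lift.
  exact: cvg_cst.
have [nu [Vnu dnu nu_dense]] := @dense_walk R _ (fun j mu => mean mu (g j))
  (fun j => continuous_mean (cg j)) V Vconn
  (fun j mu => mean_ge0_le1 compactX mu (cg j) (g01 j)) V0.
have [z [kappa [kappa_oo kappa_onto zg]]] := follow nu (fun k => Vinv _ (Vnu k)) dnu.
have znu := lift _ _ zg.
exists z; apply/seteqP; split=> mu.
  move=> [k kinc kmu].
  have muT := omega_hat_invariant compactX cT (ex_intro2 _ _ k kinc kmu).
  (* [V] is the trace of a closed set [W] on the invariant measures. The limit [mu] is invariant,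
     and the measures of [V] followed at the times [k i] also tend to it, so it lies in [W]. *)
  have /closed_subspaceP[W Wcl WV] := Vclosed.
  suff Wmu : W mu by have [] : (V `&` invariant_measures T) mu by rewrite -WV; split.
  have numu : (fun i => nu (kappa (k i))) @ \oo --> mu.
    apply: (weak_star_cvg_sub _ kmu) => f cf.
    have H := cvg_comp _ _ (homo_ltn_cvg_oo kinc) (znu f cf).
    rewrite -oppr0; under eq_fun do rewrite -opprB.
    by apply: cvgN; exact: H.
  apply: (closed_cvg W Wcl _ _ numu); apply: nearW => i.
  have : (V `&` invariant_measures T) (nu (kappa (k i))).
    by split; [exact: Vnu | exact/Vinv/Vnu].
  by rewrite -WV => -[].
move=> Vmu.
(* Times are chosen recursively: each comes after the previous one, and the measure followed there
   is close to [mu] on ever more test functions. *)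
have /choice [next nextP] : forall p : nat * nat, exists n, (p.2 < n)%N /\
    forall j, (j <= p.1)%N ->
      `|mean (nu (kappa n)) (g j) - mean mu (g j)| <= p.1.+1%:R^-1.
  (* Only indices from 2 on are known to be followed; [N.+3] leaves an index [m.+2] with m above
     [N], and thus a time n above [N]. *)
  move=> [J N]; have [[|[|m]] // Nm mP] := nu_dense mu J N.+3 Vmu.
  have [n mn nm] := kappa_onto m.
  by exists n; rewrite nm; split=> //=; exact: leq_trans mn.
pose k := fix k i := if i is i'.+1 then next (i, k i') else next (0%N, 0%N).
have kP i j : (j <= i)%N ->
    `|mean (nu (kappa (k i))) (g j) - mean mu (g j)| <= i.+1%:R^-1.
  case: i => [|i] ji.
    by have [_] := nextP (0%N, 0%N); exact.
  by have [_] := nextP (i.+1, k i); exact.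
have kinc : {homo k : i j / (i < j)%N}.
  apply: homo_ltn => [? ? ?|i]; first exact: ltn_trans.
  by have [] := nextP (i.+1, k i).
exists k => //.
apply: (@weak_star_cvg_sub _ _ _ (fun i => nu (kappa (k i)))) => [f cf|].
  exact: (cvg_comp _ _ (homo_ltn_cvg_oo kinc) (znu f cf)).
apply: (@weak_star_cvg_sub _ _ _ (fun=> mu)); last exact: cvg_cst.
apply: lift => j; apply/cvgrPdist_le => e e0.
exists (maxn j (Num.trunc e^-1)) => // i /=; rewrite geq_max => /andP[ji ei].
rewrite sub0r normrN (le_trans (kP i j ji)) //.
rewrite invf_ple ?posrE // ltW //.
by apply: (lt_le_trans (truncnS_gt _)); rewrite ler_nat.
Qed.
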